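(* Let $(\mathcal{G},X,T)$ be a decomposed graph of groups equipped with a decomposition order $\preceq$. Let $u,v\in\pi_1(\mathcal{G},X)$ be conjugate elements, and let $u_1,v_1$ be words obtained by applying the procedure of successive cyclic reductions to words on $\mathcal{G}en(X)$ representing $u$ and $v$. Then one of the following holds: (i) There exist vertices $s,s'$ of $X$ such that $u_1$ and $v_1$ are words on $\mathcal{G}en(s)$ and $\mathcal{G}en(s')$ respectively (in particular $u_1$ and $v_1$ represent in $\pi_1(\mathcal{G},X)$ elements of the vertex subgroups $G_s$, $G_{s'}$), and there exists a trajet from $u_1$ to $v_1$ in $(\mathcal{G},X,T)$. (ii) $u_1$ and $v_1$ are words on $\mathcal{G}en(X_p)$ for some $\preceq$-occurrent subgraph $X_p$ of $X$, and they represent conjugate elements of $\Gamma_p=\pi_1(\mathcal{G},X_p)$. When $X_p$ is decomposed along the edge $\alpha_{p+1}=\min(\mathcal{A}_{X_p}^+)$, $\Gamma_p$ decomposes (as an HNN extension or an amalgam), and in the sense of this decomposition $u_1,v_1$ have the same length $|u_1|=|v_1|>1$.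
   Context: A finite graph $X$ consists of finite sets $\mathcal{A}_X$ (edges) and $\mathcal{S}_X$ (vertices), a fixed-point-free involution $a\mapsto -a$ of $\mathcal{A}_X$, and maps $\mathrm{o},\mathrm{e}:\mathcal{A}_X\to\mathcal{S}_X$ (origin, end) with $\mathrm{e}(a)=\mathrm{o}(-a)$. An orientation is a subset $\mathcal{A}_X^+\subset\mathcal{A}_X$ containing exactly one of $a,-a$ for each $a$. A graph of groups $(\mathcal{G},X)$ is a finite connected oriented graph $X$ with vertex groups $G_s$ ($s\in\mathcal{S}_X$), edge groups $G_a$ ($a\in\mathcal{A}_X^+$), and monomorphisms $f_a:G_a\to G_{\mathrm{o}(a)}$, $f_{-a}:G_a\to G_{\mathrm{e}(a)}$ for $a\in\mathcal{A}_X^+$. A decomposed graph of groups $(\mathcal{G},X,T)$ is a graph of groups together with a maximal tree $T$ of $X$. Its fundamental group $\pi_1(\mathcal{G},X)$ is the quotient of the free product of all $G_s$ and the free group on $\{t_a: a\in\mathcal{A}_X\}$ by the relations $f_a(h)=t_af_{-a}(h)t_a^{-1}$ ($a\in\mathcal{A}_X^+$, $h\in G_a$), $t_{-a}=t_a^{-1}$ ($a\in\mathcal{A}_X$), $t_a=1$ ($a\in\mathcal{A}_T$). Each $G_s$ embeds naturally in $\pi_1(\mathcal{G},X)$ and is identified with its image (a vertex subgroup). For $a\in\mathcal{A}_X^+$, put $G_a^-=f_a(G_a)\subset G_{\mathrm{o}(a)}$, $G_a^+=f_{-a}(G_a)\subset G_{\mathrm{e}(a)}$ (as subgroups of $\pi_1(\mathcal{G},X)$),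 and $\varphi_a=f_{-a}\circ f_a^{-1}:G_a^-\to G_a^+$; also $G_{-a}^{\mp}=G_a^{\pm}$ and $\varphi_{-a}=\varphi_a^{-1}$. In $\pi_1(\mathcal{G},X)$, $h=t_a\varphi_a(h)t_a^{-1}$ for $h\in G_a^-$. Generators. Fix a generating set $\mathcal{G}en(s)$ of each $G_s$. For a connected subgraph $Y$ of $X$ occurring below (with maximal tree $T\cap Y$ and the induced groups and monomorphisms), $\mathcal{G}en(Y)$ is the union of the sets $\mathcal{G}en(s)$, $s\in\mathcal{S}_Y$, and $\{t_a: a\in\mathcal{A}_Y^+\setminus\mathcal{A}_T\}$; it generates $\pi_1(\mathcal{G},Y)$, which embeds naturally in $\pi_1(\mathcal{G},X)$. Words on a generating set may use inverses of generators. Decomposing along an edge. Let $Y$ be such a subgraph and $\alpha\in\mathcal{A}_Y^+$. If $\alpha\notin\mathcal{A}_T$, removing $\pm\alpha$ from $Y$ leaves a connected graph $Y_1$, and $\pi_1(\mathcal{G},Y)$ is the HNN extension of $\pi_1(\mathcal{G},Y_1)$ with stable letter $t=t_\alpha$ and $t^{-1}ht=\varphi_\alpha(h)$ for $h\in C_{-1}=G_\alpha^-$; put $C_{+1}=G_\alpha^+$. If $\alpha\in\mathcal{A}_T$, removing $\pm\alpha$ leaves two components $Y_1,Y_2$, and $\pi_1(\mathcal{G},Y)$ is the amalgam of the factors $\pi_1(\mathcal{G},Y_1)$ and $\pi_1(\mathcal{G},Y_2)$ along $\varphi_\alpha$, with amalgamated subgroup $C=G_\alpha^-=G_\alpha^+$.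 Reduced forms. In an HNN extension with base $A$, a reduced form of $g$ is an expression $g=g_1t^{\varepsilon_1}g_2\cdots t^{\varepsilon_n}g_{n+1}$ with $g_i\in A$ (written as words in generators of $A$), $\varepsilon_i=\pm1$, without any subword (pinch) $t^{\varepsilon}ct^{-\varepsilon}$ with $c\in C_\varepsilon$; the length is $|g|=n+1$. It is cyclically reduced if $|g|=1$, or $g_{n+1}=1$ and either $|g|=2$, or $|g|>2$ and $t^{\varepsilon_n}g_1t^{\varepsilon_1}$ is not a pinch. In an amalgam, $|g|=1$ if $g$ is in a factor; otherwise a reduced form is $g=g_1\cdots g_n$, $n\geq 2$, with each $g_i$ in a factor but not in $C$ (written as a word in generators of that factor) and consecutive $g_i$ in different factors, and $|g|=n$. It is cyclically reduced if $|g|=1$ or if $g_1,g_n$ are in different factors. Every element is conjugate to a cyclically reduced one. Decomposition order. A decomposition order is a total order $\preceq$ on $\mathcal{A}_X^+$ such that $\alpha\preceq\beta$ for all $\alpha\in\mathcal{A}_X^+\setminus\mathcal{A}_T^+$ and $\beta\in\mathcal{A}_T^+$. A subgraph $Y$ is $\preceq$-occurrent if $Y=X$ or if, for some $n\ge1$, $Y$ is a connected component of the graph obtained from $X$ by decomposing along (removing) the first $n$ elements of $(\mathcal{A}_X^+,\preceq)$. Procedure of successive cyclic reductions (applied to a word $w$ on $\mathcal{G}en(X)$). Start with $Y=X$. If $Y$ is a single vertex without edges, stop and output the current word. Otherwise decompose $Y$ along $\alpha=\min_\preceq(\mathcal{A}_Y^+)$ and replace the current word by a word on $\mathcal{G}en(Y)$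 that is cyclically reduced for the resulting HNN or amalgam decomposition of $\pi_1(\mathcal{G},Y)$ and represents a conjugate, in $\pi_1(\mathcal{G},Y)$, of the current element. If this new word has length $>1$, stop and output it. If it has length $1$, it is taken to be a word on $\mathcal{G}en(Y_1)$ (HNN case), or on $\mathcal{G}en(Y_1)$ or $\mathcal{G}en(Y_2)$ (amalgam case); repeat with $Y$ replaced by that $Y_i$ and the induced order. The output is a word $w_1$ representing a conjugate of $w$ in $\pi_1(\mathcal{G},X)$, together with the $\preceq$-occurrent subgraph $Y=X_p$ at which the procedure stops. Trajets. Let $x\in G_{s_o}$, $y\in G_{s_e}$. A trajet from $x$ to $y$ with origin $s_o$ and end $s_e$ consists of: a path $(a_1,\dots,a_n)$ in $X$, $n\ge 0$, from $s_0=s_o$ to $s_n=s_e$ (with $s_i=\mathrm{e}(a_i)=\mathrm{o}(a_{i+1})$ for $0<i<n$; if $n=0$ the path is the single vertex $s_o=s_e$); elements $c_i^-\in G_{a_i}^-$, $c_i^+\in G_{a_i}^+$ with $c_i^+=\varphi_{a_i}(c_i^-)$, $i=1,\dots,n$; and elements $h_i\in G_{s_i}$, $i=0,\dots,n$, such that, if $n=0$, $x=h_0yh_0^{-1}$, and if $n\ge1$, $x=h_0c_1^-h_0^{-1}$, $c_i^+=h_ic_{i+1}^-h_i^{-1}$ for $1\le i\le n-1$, and $c_n^+=h_nyh_n^{-1}$. Existence of a trajet from $x$ to $y$ does not depend on the choice of vertices $s_o,s_e$ with $x\in G_{s_o}$, $y\in G_{s_e}$. *)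

(* Defs.v *)
(* A [groupType] may be infinite; the classical library is used for subsets and
   for quotients by undecidable congruences. *)
From HB Require Import structures.
From mathcomp Require Import all_boot.
From mathcomp Require Import boolp classical_sets.

Set Implicit Arguments.
Unset Strict Implicit.
Unset Printing Implicit Defensive.

Local Open Scope group_scope.
Local Open Scope quotient_scope.

(* A word on [L] is a sequence of signed letters: [(l, true)] stands for [l] and
   [(l, false)] for its inverse. *)
Definition word (L : Type) : Type := seq (L * bool).

Definition word_val (L : Type) (G : groupType) (f : L -> G) (w : word L) : G :=
  \prod_(x <- w) (if x.2 then f x.1 else (f x.1)^-1).

Definition generates (G : groupType) (S : set G) : Prop :=
  forall g : G, exists2 w : word G,
    (forall x, x \in w -> S x.1) & word_val id w = g.

Definition conjugate (G : groupType) (x y : G) : Prop :=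
  exists g : G, y = x ^ g.

Section Presentation.
Variables (L : choiceType) (R : word L -> word L -> Prop).

Inductive pres_eq : word L -> word L -> Prop :=
| pres_rel w w' : R w w' -> pres_eq w w'
| pres_cancel l b : pres_eq [:: (l, b); (l, ~~ b)] [::]
| pres_cat w1 w1' w2 w2' :
    pres_eq w1 w1' -> pres_eq w2 w2' -> pres_eq (w1 ++ w2) (w1' ++ w2')
| pres_refl w : pres_eq w w
| pres_sym w w' : pres_eq w w' -> pres_eq w' w
| pres_trans w1 w2 w3 : pres_eq w1 w2 -> pres_eq w2 w3 -> pres_eq w1 w3.

Definition pres_eqb : rel (seq (L * bool)) := fun w w' => `[< pres_eq w w' >].

Lemma pres_eqb_equiv : equiv_class_of pres_eqb.
Proof.
split=> [w|w w'|w2 w1 w3].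
- exact/asboolP/pres_refl.
- by apply/asboolP/asboolP; exact: pres_sym.
- by move=> /asboolP h /asboolP h'; apply/asboolP/(pres_trans h).
Qed.

Canonical pres_equiv := EquivRelPack pres_eqb_equiv.

(* The group < L | R >. *)
Definition presented : Type := {eq_quot pres_equiv}.
HB.instance Definition _ := Choice.on presented.
HB.instance Definition _ := EqQuotient.on presented.

Definition pres_class (w : seq (L * bool)) : presented := \pi_presented w.

Lemma pres_classP w w' : pres_class w = pres_class w' <-> pres_eq w w'.
Proof.
split=> [/eqquotP/asboolP //|h]; exact/eqquotP/asboolP.
Qed.

Lemma pres_class_repr (g : presented) : pres_class (repr g) = g.
Proof. exact: reprK. Qed.

Definition winv (w : seq (L * bool)) : seq (L * bool) :=
  rev [seq (x.1, ~~ x.2) | x <- w].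

Lemma pres_winvl w : pres_eq (winv w ++ w) [::].
Proof.
elim: w => [|[l b] w ih]; first exact: pres_refl.
rewrite /winv /= rev_cons -cats1 -catA cat1s.
apply: (pres_trans _ ih).
apply: pres_cat; first exact: pres_refl.
rewrite -[X in pres_eq _ X]cat0s -[(l, ~~ b) :: _]/([:: (l, ~~ b); (l, b)] ++ w).
apply: pres_cat; last exact: pres_refl.
by rewrite -{2}[b]negbK; apply: pres_cancel.
Qed.

Lemma winvK : involutive winv.
Proof.
move=> w; rewrite /winv map_rev revK -map_comp map_id_in //.
by case=> l b _ /=; rewrite negbK.
Qed.

Lemma pres_winvr w : pres_eq (w ++ winv w) [::].
Proof. by rewrite -{1}[w]winvK; exact: pres_winvl. Qed.

Definition pres_mul (g h : presented) := pres_class (repr g ++ repr h).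
Definition pres_one := pres_class [::].
Definition pres_inv (g : presented) := pres_class (winv (repr g)).

Lemma repr_class w : pres_eq (repr (pres_class w)) w.
Proof. by apply/pres_classP; rewrite pres_class_repr. Qed.

Lemma pres_mulA : associative pres_mul.
Proof.
move=> x y z; apply/pres_classP.
apply: (pres_trans (w2 := repr x ++ (repr y ++ repr z))).
  by apply: pres_cat; [exact: pres_refl|exact: repr_class].
rewrite catA; apply: pres_cat; last exact: pres_refl.
exact/pres_sym/repr_class.
Qed.

Lemma pres_mul1g : left_id pres_one pres_mul.
Proof.
move=> x; rewrite -[RHS]pres_class_repr; apply/pres_classP.
rewrite -[X in pres_eq _ X]cat0s.
by apply: pres_cat; [exact: repr_class|exact: pres_refl].
Qed.

Lemma pres_mulg1 : right_id pres_one pres_mul.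
Proof.
move=> x; rewrite -[RHS]pres_class_repr; apply/pres_classP.
rewrite -[X in pres_eq _ X]cats0.
by apply: pres_cat; [exact: pres_refl|exact: repr_class].
Qed.

Lemma pres_mulVg : left_inverse pres_one pres_inv pres_mul.
Proof.
move=> x; apply/pres_classP; apply: (pres_trans _ (pres_winvl (repr x))).
by apply: pres_cat; [exact: repr_class|exact: pres_refl].
Qed.

Lemma pres_mulgV : right_inverse pres_one pres_inv pres_mul.
Proof.
move=> x; apply/pres_classP; apply: (pres_trans _ (pres_winvr (repr x))).
by apply: pres_cat; [exact: pres_refl|exact: repr_class].
Qed.

HB.instance Definition _ :=
  isGroup.Build presented pres_mulA pres_mul1g pres_mulg1 pres_mulVg pres_mulgV.

End Presentation.

Record graph : Type := Graph {
  vertex : finType;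
  edge : finType;
  opp : edge -> edge;
  org : edge -> vertex;
  end_ : edge -> vertex;
  oppK : involutive opp;
  opp_neq : forall a, opp a != a;
  end_org : forall a, end_ a = org (opp a) }.

Definition is_orientation (X : graph) (P : {set edge X}) : Prop :=
  forall a : edge X, (opp a \in P) = (a \notin P).

Record subgraph (X : graph) : Type := Subgraph {
  sverts : {set vertex X};
  sedges : {set edge X};
  subgraph_closed :
    [forall a in sedges, (opp a \in sedges) && (org a \in sverts)] }.

Section Subgraphs.
Variable X : graph.
Implicit Types (Y Z : subgraph X) (E : {set edge X}).

Lemma subgraphP Y a : a \in sedges Y -> opp a \in sedges Y /\ org a \in sverts Y.
Proof. by move=> aY; have /forall_inP/(_ a aY)/andP := subgraph_closed Y. Qed.

Fact full_closed :
  [forall a in [set: edge X], (opp a \in [set: edge X]) && (org a \in [set: vertex X])].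
Proof. by apply/forall_inP=> a _; rewrite !inE. Qed.
Definition full : subgraph X := Subgraph full_closed.

Fact single_closed (s : vertex X) :
  [forall a in (finset.set0 : {set edge X}),
     (opp a \in (finset.set0 : {set edge X})) && (org a \in [set s])].
Proof. by apply/forall_inP=> a; rewrite finset.in_set0. Qed.
Definition single s : subgraph X := Subgraph (single_closed s).

Definition removed_edges Y E :=
  [set a in sedges Y | (a \notin E) && (opp a \notin E)].
Fact remove_closed Y E :
  [forall a in removed_edges Y E,
     (opp a \in removed_edges Y E) && (org a \in sverts Y)].
Proof.
apply/forall_inP=> a; rewrite !inE oppK => /and3P[/subgraphP[-> ->] -> ->] //.
Qed.
(* [Y] without the edges [a] and [-a], for [a] in [E]. *)
Definition remove Y E : subgraph X := Subgraph (remove_closed Y E).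

Definition adj Y : rel (vertex X) :=
  fun s s' => [exists a in sedges Y, (org a == s) && (end_ a == s')].

Definition comp_verts Y s := [set s' in sverts Y | connect (adj Y) s s'].
Definition comp_edges Y s := [set a in sedges Y | connect (adj Y) s (org a)].
Fact component_closed Y s :
  [forall a in comp_edges Y s,
     (opp a \in comp_edges Y s) && (org a \in comp_verts Y s)].
Proof.
apply/forall_inP=> a; rewrite !inE => /andP[aY sa].
have [-> ->] := subgraphP aY; rewrite sa /= andbT.
apply: connect_trans sa (connect1 _); apply/exists_inP; exists a => //.
by rewrite eqxx end_org eqxx.
Qed.
(* The connected component of the vertex [s] in [Y]. *)
Definition component Y s : subgraph X := Subgraph (component_closed Y s).

Definition connected Y : Prop :=
  sverts Y != finset.set0 /\ {in sverts Y &, forall s s', connect (adj Y) s s'}.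

(* A closed path without backtracking that visits no vertex twice. *)
Definition circuit Y (p : seq (edge X)) : bool :=
  [&& p != [::], all (mem (sedges Y)) p,
      cycle (fun a b => (end_ a == org b) && (b != opp a)) p
    & uniq (map (@org X) p)].

Definition is_tree Y : Prop := connected Y /\ forall p, ~~ circuit Y p.

Definition maximal_tree Y : Prop :=
  is_tree Y /\
  forall Z, is_tree Z -> sverts Y \subset sverts Z -> sedges Y \subset sedges Z ->
    Z = Y.

End Subgraphs.

(* [f_org a] and [f_end a] are the monomorphisms f_a and f_{-a}. *)
Record graph_of_groups : Type := GraphOfGroups {
  gog_graph :> graph;
  gog_connected : connected (full gog_graph);
  pos : {set edge gog_graph};
  pos_orientation : is_orientation pos;
  vgrp : vertex gog_graph -> groupType;
  egrp : {a | a \in pos} -> groupType;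
  f_org : forall a : {a | a \in pos}, {multiplicative egrp a -> vgrp (org (val a))};
  f_end : forall a : {a | a \in pos}, {multiplicative egrp a -> vgrp (end_ (val a))};
  f_org_inj : forall a, injective (f_org a);
  f_end_inj : forall a, injective (f_end a) }.

Definition pos_edge (X : graph_of_groups) : Type := {a | a \in pos X}.
HB.instance Definition _ X := Finite.on (pos_edge X).

Record decomposed_graph_of_groups : Type := DecomposedGraphOfGroups {
  dgog_gog :> graph_of_groups;
  tree : subgraph dgog_gog;
  tree_maximal : maximal_tree tree }.

(* An element of a vertex group, or a symbol t_a. *)
Definition letter (X : graph_of_groups) : Type :=
  ({s : vertex X & vgrp s} + edge X)%type.
HB.instance Definition _ X := Choice.on (letter X).

Section FundamentalGroup.
Variable X : decomposed_graph_of_groups.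
Implicit Type Y : subgraph X.

Definition vlet (s : vertex X) (x : vgrp s) : letter X := inl (Tagged (fun s => vgrp s) x).
Definition tlet (a : edge X) : letter X := inr a.

(* The multiplication tables of the vertex groups present their free product. *)
Inductive pi1_rel : word (letter X) -> word (letter X) -> Prop :=
| rel_vertex s (x y : vgrp s) :
    pi1_rel [:: (vlet x, true); (vlet y, true)] [:: (vlet (x * y), true)]
| rel_edge (a : pos_edge X) (h : egrp a) :
    pi1_rel [:: (vlet (f_org a h), true)]
      [:: (tlet (val a), true); (vlet (f_end a h), true); (tlet (val a), false)]
| rel_opp (a : edge X) :
    pi1_rel [:: (tlet (opp a), true)] [:: (tlet a, false)]
| rel_tree (a : edge X) :
    a \in sedges (tree X) -> pi1_rel [:: (tlet a, true)] [::].

Definition letter_in Y : pred (letter X) := fun l =>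
  match l with
  | inl x => tag x \in sverts Y
  | inr a => a \in sedges Y
  end.

Definition pi1_rel_in Y (w w' : word {l | letter_in Y l}) : Prop :=
  pi1_rel [seq (val x.1, x.2) | x <- w] [seq (val x.1, x.2) | x <- w'].

(* The fundamental group of the graph of groups induced on [Y], relative to
   the intersection of the tree with [Y]; [pi1 (full X)] is the one of [X]. *)
Definition pi1 Y : Type := presented (@pi1_rel_in Y).
HB.instance Definition _ Y := Group.on (pi1 Y).

(* Letters outside [Y] get the junk value 1; below, words are evaluated in
   [pi1 Y] only when all their letters are in [Y]. *)
Definition letter_val Y (l : letter X) : pi1 Y :=
  if insub l is Some l' then pres_class (@pi1_rel_in Y) [:: (l', true)] else 1.

Definition wval Y (w : word (letter X)) : pi1 Y := word_val (letter_val Y) w.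

(* The natural map from a vertex group to [pi1 Y]. *)
Definition vertex_val Y (s : vertex X) (x : vgrp s) : pi1 Y :=
  letter_val Y (vlet x).

End FundamentalGroup.

Section Words.
Variable X : decomposed_graph_of_groups.
Variable Gen : forall s : vertex X, set (vgrp s).
Implicit Type Y : subgraph X.

Definition in_Gen Y (l : letter X) : Prop :=
  match l with
  | inl x => tag x \in sverts Y /\ Gen (tagged x)
  | inr a => [/\ a \in sedges Y, a \in pos X & a \notin sedges (tree X)]
  end.

Definition word_on Y (w : word (letter X)) : Prop :=
  forall x, x \in w -> in_Gen Y x.1.

(* [edge_subgroup Y a e] is G_a^+ if [e] and G_a^- otherwise, inside [pi1 Y]:
   in the HNN case these are C_{+1} and C_{-1}, in the amalgam case both are C. *)
Definition edge_subgroup Y (a : pos_edge X) (e : bool) : set (pi1 Y) :=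
  [set g | exists h : egrp a,
     g = if e then vertex_val Y (f_end a h) else vertex_val Y (f_org a h)]%classic.

Section Decomposition.
Variables (Y : subgraph X) (a : pos_edge X).

Definition base : subgraph X := remove Y [set val a].
Definition factor (i : bool) : subgraph X :=
  component base (if i then end_ (val a) else org (val a)).

(* HNN case: the expression g_1 t^e_1 ... g_n t^e_n g_{n+1} is given by the
   sequence [p] of the pairs (g_i, e_i), where [true] is +1 and [false] is -1,
   and by the last word [g] = g_{n+1}; its length is n+1. *)
Definition pinch (e : bool) (c : word (letter X)) (e' : bool) : Prop :=
  e' = ~~ e /\ edge_subgroup a e (wval Y c).

Definition hnn_word (p : seq (word (letter X) * bool)) (g : word (letter X)) :
    word (letter X) :=
  flatten [seq x.1 ++ [:: (tlet (val a), x.2)] | x <- p] ++ g.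

Definition hnn_reduced (p : seq (word (letter X) * bool)) g : Prop :=
  [/\ forall x, x \in p -> word_on base x.1, word_on base g
    & forall p1 p2 g1 e1 g2 e2,
        p = p1 ++ (g1, e1) :: (g2, e2) :: p2 -> ~ pinch e1 g2 e2].

Definition hnn_cyclically_reduced (p : seq (word (letter X) * bool)) g : Prop :=
  hnn_reduced p g /\
  match p with
  | [::] => True
  | (g1, e1) :: p' => wval Y g = 1 /\
      (p' = [::] \/ ~ pinch (last e1 (map snd p')) g1 e1)
  end.

(* Amalgam case: the expression g_1 ... g_n is given by the sequence [p] of the
   pairs (i, g_j), where [i] is the index of the factor containing g_j. *)
Definition amalgam_word (p : seq (bool * word (letter X))) : word (letter X) :=
  flatten (map snd p).

Definition amalgam_reduced (p : seq (bool * word (letter X))) : Prop :=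
  [/\ p <> [::], forall x, x \in p -> word_on (factor x.1) x.2
    & 1 < size p ->
      (forall x, x \in p -> ~ edge_subgroup a false (wval Y x.2)) /\
      sorted (fun i j => i != j) (map fst p)].

Definition amalgam_cyclically_reduced (p : seq (bool * word (letter X))) : Prop :=
  amalgam_reduced p /\
  (size p = 1%N \/ head true (map fst p) <> last true (map fst p)).

(* [w] is a cyclically reduced form of length [n] for the decomposition of
   [pi1 Y] along [a]. *)
Definition cyclically_reduced_word (w : word (letter X)) (n : nat) : Prop :=
  if val a \in sedges (tree X) then
    exists p, [/\ amalgam_cyclically_reduced p, w = amalgam_word p & n = size p]
  else
    exists p g, [/\ hnn_cyclically_reduced p g, w = hnn_word p g & n = (size p).+1].

(* The length of the element [g] for the decomposition of [pi1 Y] along [a]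
   is [n], i.e. [g] has a reduced form of length [n]. *)
Definition has_length (g : pi1 Y) (n : nat) : Prop :=
  if val a \in sedges (tree X) then
    exists p, [/\ amalgam_reduced p, g = wval Y (amalgam_word p) & n = size p]
  else
    exists p g', [/\ hnn_reduced p g', g = wval Y (hnn_word p g') & n = (size p).+1].

(* The subgraphs left when [Y] is decomposed along [a]. *)
Definition is_piece (Z : subgraph X) : Prop :=
  if val a \in sedges (tree X) then exists i, Z = factor i else Z = base.

End Decomposition.

Section Procedure.
Variable le : rel (pos_edge X).

Definition decomposition_order : Prop :=
  [/\ reflexive le, antisymmetric le, transitive le, total le
    & forall a b : pos_edge X,
        val a \notin sedges (tree X) -> val b \in sedges (tree X) -> le a b].

Definition min_edge Y (a : pos_edge X) : Prop :=
  val a \in sedges Y /\ forall b : pos_edge X, val b \in sedges Y -> le a b.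

Definition first_edges (n : nat) : {set edge X} :=
  [set a in map val (take n (sort le (enum {: pos_edge X})))].

Definition occurrent Y : Prop :=
  Y = full X \/
  exists n s, 1 <= n <= #|{: pos_edge X}| /\ Y = component (remove (full X) (first_edges n)) s.

(* [cyclic_reductions Y w w1 Z]: started at [Y] with the word [w], the procedure
   may stop at [Z] with the output [w1]. *)
Inductive cyclic_reductions :
    subgraph X -> word (letter X) -> word (letter X) -> subgraph X -> Prop :=
| reductions_vertex s w : cyclic_reductions (single s) w w (single s)
| reductions_stop Y a w w1 n :
    min_edge Y a -> word_on Y w1 -> cyclically_reduced_word Y a w1 n ->
    conjugate (wval Y w) (wval Y w1) -> 1 < n ->
    cyclic_reductions Y w w1 Y
| reductions_step Y a w w' Y' w1 Z :
    min_edge Y a -> word_on Y w' -> cyclically_reduced_word Y a w' 1 ->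
    conjugate (wval Y w) (wval Y w') ->
    is_piece Y a Y' -> word_on Y' w' ->
    cyclic_reductions Y' w' w1 Z ->
    cyclic_reductions Y w w1 Z.

End Procedure.
End Words.

Section Trajets.
Variable X : graph_of_groups.

(* [edge_map a c c'], for an edge [a] of either sign: [c] is in G_a^-, [c'] is
   in G_a^+ and phi_a(c) = c'. The vertices [s] and [s'] are forced to be the
   origin and the end of [a]. *)
Inductive edge_map : edge X -> forall s s' : vertex X, vgrp s -> vgrp s' -> Prop :=
| edge_map_pos (a : pos_edge X) (h : egrp a) :
    edge_map (val a) (f_org a h) (f_end a h)
| edge_map_neg (a : pos_edge X) (h : egrp a) :
    edge_map (opp (val a)) (f_end a h) (f_org a h).

(* Existence of a trajet from [x] to [y], by recursion on the path: the first
   step gives x = h_0 c_1^- h_0^-1 and c_1^+ = phi(c_1^-), and is followed by a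
   trajet from c_1^+ to [y]. *)
Inductive trajet : forall s s' : vertex X, vgrp s -> vgrp s' -> Prop :=
| trajet_nil s (x y h : vgrp s) : x = h * y * h^-1 -> trajet x y
| trajet_cons (a : edge X) s s1 s' (x h c : vgrp s) (c' : vgrp s1) (y : vgrp s') :
    x = h * c * h^-1 -> edge_map a c c' -> trajet c' y -> trajet x y.

End Trajets.

(* Main.v *)
Require Import Defs.
From HB Require Import structures.
From mathcomp Require Import all_boot.
From mathcomp Require Import boolp classical_sets.

Set Implicit Arguments.
Unset Strict Implicit.
Unset Printing Implicit Defensive.

(** Call an element of [pi1 Y] elliptic if it is conjugate to an element of a vertex
    group. The theorem is a dichotomy between elliptic and non-elliptic elements, and
    it rests on two facts about the decomposition of [pi1 Y] along an edge.

    - Collins' lemma ([conj_split_chain]): two elements of the pieces that are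
      conjugate in [pi1 Y] are linked by conjugations in the pieces and passages
      through the edge. In particular they are conjugate in the same piece, unless
      both are conjugate in their pieces to elements of the edge group, so are elliptic
      there.
    - Conjugate cyclically reduced elements have the same length, if both lengths are
      greater than 1 ([cyclically_reduced_size]), and an element with a cyclically
      reduced form of length greater than 1 is not conjugate to an element of a piece
      ([cyclically_reduced_not_piece]).

    If the given elements are elliptic, the second fact prevents the procedure from
    stopping before it reaches a vertex, and by the first one the element remains
    elliptic in each piece ([elliptic_output]). The outputs lie in vertex groups, and
    iterating Collins' lemma down to single vertices gives a trajet ([good_trajets]).
    If they are not elliptic, the two runs go through the same subgraphs, with conjugate
    elements, until both stop in the same subgraph with the same length
    ([hyperbolic_outputs]).

    Both facts are proved once, for HNN extensions, by letting the extension act on its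
    normal forms ([hnn_conj_chain], [cyclic_len_le]). An amalgam of G and H along C is
    treated by mapping it to the HNN extension of G x H that conjugates the two copies
    of C; this map carries reduced forms to reduced forms. The embedding of
    vertex groups, which makes the edge groups embed in the pieces, is part of the same
    induction as the trajets: a trajet to the trivial element starts at the trivial
    element ([trajets_vertex_inj]). *)

Local Open Scope group_scope.

(** * Bijections of a type form a group *)
Section Bijections.
Variable T : Type.

Record bij : Type := Bij {
  bij_fun :> T -> T;
  bij_inv : T -> T;
  bij_funK : cancel bij_fun bij_inv;
  bij_invK : cancel bij_inv bij_fun }.

Lemma bij_eq (s s' : bij) : s =1 s' -> s = s'.
Proof.
case: s s' => [f g fK gK] [f' g' fK' gK'] /= /funext ff; subst f'.
have gg : g = g' by apply: funext => x; rewrite -{1}[x]gK' fK.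
by subst g'; congr Bij; exact: Prop_irrelevance.
Qed.

HB.instance Definition _ := gen_eqMixin bij.
HB.instance Definition _ := gen_choiceMixin bij.

Definition bij_one : bij := @Bij id id (fun=> erefl) (fun=> erefl).
Definition bij_mul (s s' : bij) : bij :=
  Bij (can_comp (bij_funK s) (bij_funK s')) (can_comp (bij_invK s') (bij_invK s)).
Definition bij_opp (s : bij) : bij := Bij (bij_invK s) (bij_funK s).

Fact bij_mulA : associative bij_mul. Proof. by move=> *; exact: bij_eq. Qed.
Fact bij_mul1g : left_id bij_one bij_mul. Proof. by move=> *; exact: bij_eq. Qed.
Fact bij_mulg1 : right_id bij_one bij_mul. Proof. by move=> *; exact: bij_eq. Qed.
Fact bij_mulVg : left_inverse bij_one bij_opp bij_mul.
Proof. by move=> s; apply: bij_eq => x /=; rewrite bij_funK. Qed.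
Fact bij_mulgV : right_inverse bij_one bij_opp bij_mul.
Proof. by move=> s; apply: bij_eq => x /=; rewrite bij_invK. Qed.
HB.instance Definition _ :=
  isGroup.Build bij bij_mulA bij_mul1g bij_mulg1 bij_mulVg bij_mulgV.

Lemma bijM (s s' : bij) x : (s * s') x = s (s' x). Proof. by []. Qed.

End Bijections.

(** * HNN extensions: normal forms, conjugacy and cyclic lengths *)

Section HNN.
Variables (A C : groupType) (f : bool -> C -> A).
Hypothesis fM : forall e, {morph f e : c d / c * d}.
Hypothesis f_inj : forall e, injective (f e).

(** The edge group [C] embeds in [A] by [f true] and by [f false], with images C_{+1}
    and C_{-1}; the stable letter t satisfies t (f true c) = (f false c) t. *)
Definition in_edge (e : bool) (a : A) : Prop := exists c, a = f e c.

Lemma edge_map1 e : f e 1 = 1.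
Proof. by apply: (mulgI (f e 1)); rewrite -fM !mulg1. Qed.

Lemma edge_mapV e c : f e c^-1 = (f e c)^-1.
Proof. by apply: (mulgI (f e c)); rewrite -fM !mulgV edge_map1. Qed.

(** [r] lies in the right coset of [a] modulo the image of [f e], and is 1 when that
    coset is the subgroup itself. Equal cosets give equal sets, so that choosing an
    element of this set is a choice of coset representatives. *)
Definition coset_spec (e : bool) (a : A) : set A :=
  [set r | (exists c, a = f e c * r) /\ (in_edge e a -> r = 1)]%classic.
Definition coset_rep e a : A := xget 1 (coset_spec e a).
(** In a = (f e c) r, with [r] the representative of the coset of [a], this is [c]. *)
Definition edge_part e a : C := xget 1 [set c | a = f e c * coset_rep e a]%classic.

Lemma coset_repP e a : coset_spec e a (coset_rep e a).
Proof.
apply: xgetPex; have [[c ac]|na] := pselect (in_edge e a).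
- by exists 1; split=> //; exists c; rewrite mulg1.
- by exists a; split=> //; exists 1; rewrite edge_map1 mul1g.
Qed.

Lemma coset_rep1 e a : coset_rep e a = 1 <-> in_edge e a.
Proof.
have [[c ac] h] := coset_repP e a; split=> // r1.
by exists c; rewrite {1}ac r1 mulg1.
Qed.

Lemma edge_partE e a : a = f e (edge_part e a) * coset_rep e a.
Proof.
apply: (@xgetPex _ 1 [set c | a = f e c * coset_rep e a]%classic).
by have [] := coset_repP e a.
Qed.

Lemma coset_repM e c a : coset_rep e (f e c * a) = coset_rep e a.
Proof.
congr (xget 1 _); apply/seteqP; split=> r [[d dr] h]; split.
- by exists (c^-1 * d); rewrite fM edge_mapV -mulgA -dr mulKg.
- by case=> d' ad; apply: h; exists (c * d'); rewrite fM ad.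
- by exists (c * d); rewrite fM -mulgA -dr.
- by case=> d' ad; apply: h; exists (c^-1 * d'); rewrite fM edge_mapV -ad mulKg.
Qed.

Lemma edge_partM e c r : coset_rep e r = r -> edge_part e (f e c * r) = c.
Proof.
move=> rr; have := edge_partE e (f e c * r); rewrite coset_repM rr.
by move/mulIg/f_inj.
Qed.

(** The tail t^e1 r1 ... t^en rn of a normal form a t^e1 r1 ... t^en rn, as the list of
    the pairs (ei, ri). *)
Fixpoint normal_tail (l : seq (bool * A)) : Prop :=
  match l with
  | [::] => True
  | (e, r) :: l' => [/\ coset_rep e r = r,
      match l' with [::] => True | (e', _) :: _ => r = 1 -> e' = e end
      & normal_tail l']
  end.

Definition omega : Type := {x : A * seq (bool * A) | `[< normal_tail x.2 >]}.

Definition omega_len (x : omega) : nat := size (val x).2.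

(** Left multiplication by t^e of the normal form [x]: with a = (f e c) r one has
    t^e a = (f (~~ e) c) t^e r, and t^e cancels against a following t^(~~ e) if r = 1. *)
Definition step (e : bool) (x : A * seq (bool * A)) : A * seq (bool * A) :=
  let push := (f (~~ e) (edge_part e x.1), (e, coset_rep e x.1) :: x.2) in
  match x.2 with
  | [::] => push
  | (e', r) :: l =>
      if `[< e' = ~~ e /\ coset_rep e x.1 = 1 >]
      then (f (~~ e) (edge_part e x.1) * r, l) else push
  end.

Variant step_spec e a l : A * seq (bool * A) -> Prop :=
| StepPop r l' of l = (~~ e, r) :: l' & in_edge e a :
    step_spec e a l (f (~~ e) (edge_part e a) * r, l')
| StepPush of (forall r l', l = (~~ e, r) :: l' -> ~ in_edge e a) :
    step_spec e a l (f (~~ e) (edge_part e a), (e, coset_rep e a) :: l).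

Lemma stepP e a l : step_spec e a l (step e (a, l)).
Proof.
rewrite /step /=; case: l => [|[e' r] l] /=; first exact: StepPush.
case: asboolP => [[-> /coset_rep1 ea]|h]; first exact: StepPop.
by apply: StepPush => r' l' [ee _ _] /coset_rep1 ea; apply: h.
Qed.

Lemma coset_rep_id e a : coset_rep e (coset_rep e a) = coset_rep e a.
Proof. by rewrite {2}(edge_partE e a) coset_repM. Qed.

Lemma step_normal e a l : normal_tail l -> normal_tail (step e (a, l)).2.
Proof.
case: stepP => [r l' -> _ [] //|h nl]; split=> //; first exact: coset_rep_id.
case: l h nl => [|[e' r] l'] // h _ /coset_rep1 ea.
have [//|ne] := eqVneq e' e.
by case: (h r l' _ ea); congr ((_, _) :: _); case: (e) (e') ne => [] [].
Qed.

(** Multiplying by t^e and then by its inverse restores a normal form: what the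
    first step pushes, the second one pops, and what it pops is pushed again since
    a normal form has no pinch there. *)
Lemma stepK e a l : normal_tail l -> step (~~ e) (step e (a, l)) = (a, l).
Proof.
case: stepP => [r l' -> ea [rr hl' _]|h nl].
- case: stepP => [r' l''|_].
  + rewrite negbK => el' [c rc]; subst l'.
    suff r1 : r = 1 by case: (e) (hl' r1).
    rewrite -rr; apply/coset_rep1; exists ((edge_part e a)^-1 * c).
    by rewrite fM edge_mapV -rc mulKg.
  + rewrite coset_repM rr edge_partM // negbK; congr (_, _).
    by rewrite [RHS](edge_partE e) (proj2 (coset_rep1 e a) ea) mulg1.
- have c1 d : f (~~ e) d = f (~~ e) d * 1 by rewrite mulg1.
  have r1 : coset_rep (~~ e) 1 = 1 by apply/coset_rep1; exists 1; rewrite edge_map1.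
  case: stepP => [r' l'|].
  + rewrite c1 edge_partM // !negbK => -[<- <-] _.
    by rewrite -edge_partE.
  + rewrite negbK => /(_ _ _ erefl) []; by exists (edge_part e a).
Qed.

Lemma step_subproof e (x : omega) : `[< normal_tail (step e (val x)).2 >].
Proof. by apply/asboolP; case: x => -[a l] /= /asboolP; exact: step_normal. Qed.
Definition omega_step e (x : omega) : omega :=
  exist (fun x => `[< normal_tail x.2 >]) _ (step_subproof e x).

Lemma omega_stepK e : cancel (omega_step e) (omega_step (~~ e)).
Proof.
by case=> -[a l] nl; apply: val_inj => /=; rewrite stepK //; exact/asboolP.
Qed.
Lemma omega_stepVK e : cancel (omega_step (~~ e)) (omega_step e).
Proof. by rewrite -{2}[e]negbK; exact: omega_stepK. Qed.

Definition omega_mul (a : A) (x : omega) : omega :=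
  exist (fun x => `[< normal_tail x.2 >]) (a * (val x).1, (val x).2) (valP x).
Lemma omega_mulK a : cancel (omega_mul a) (omega_mul a^-1).
Proof. by case=> -[b l] nl; apply: val_inj => /=; rewrite mulKg. Qed.
Lemma omega_mulVK a : cancel (omega_mul a^-1) (omega_mul a).
Proof. by case=> -[b l] nl; apply: val_inj => /=; rewrite mulVKg. Qed.

(** The HNN extension of [A] acts on the left of the set of normal forms: there [A]
    acts by [of_base] and the stable letter and its inverse by [tstable]. Words in these
    bijections satisfy the relations of the HNN extension. *)
Definition hnn : Type := bij omega.
HB.instance Definition _ := Group.on hnn.
Definition of_base a : hnn := Bij (omega_mulK a) (omega_mulVK a).
Definition tstable e : hnn := Bij (omega_stepK e) (omega_stepVK e).

Lemma of_baseM : {morph of_base : a b / a * b}.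
Proof.
move=> a b; apply: bij_eq => x; apply: val_inj => /=.
by rewrite mulgA.
Qed.

Lemma of_base1 : of_base 1 = 1.
Proof. by apply: (mulgI (of_base 1)); rewrite -of_baseM !mulg1. Qed.

Lemma of_baseV a : of_base a^-1 = (of_base a)^-1.
Proof. by apply: (mulgI (of_base a)); rewrite -of_baseM !mulgV of_base1. Qed.

Lemma tstableN e : tstable (~~ e) = (tstable e)^-1.
Proof. exact: bij_eq. Qed.

Lemma tstable_of_base e c :
  tstable e * of_base (f e c) = of_base (f (~~ e) c) * tstable e.
Proof.
apply: bij_eq => -[[a l] nl]; apply: val_inj => /=.
have cM : edge_part e (f e c * a) = c * edge_part e a.
  by rewrite {1}[a](edge_partE e) mulgA -fM edge_partM // coset_rep_id.
rewrite /step /= coset_repM cM fM.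
by case: l nl => [|[e' r] l] nl //=; case: asboolP => _ /=; rewrite ?mulgA.
Qed.

Fact base_subproof (v : A) : `[< normal_tail (v, [::] : seq (bool * A)).2 >].
Proof. exact/asboolP. Qed.
Definition omega_base v : omega :=
  exist (fun x => `[< normal_tail x.2 >]) _ (base_subproof v).

Lemma of_base_inj : injective of_base.
Proof.
move=> a b /(congr1 (fun s : hnn => (val (s (omega_base 1))).1)) /=.
by rewrite !mulg1.
Qed.

Definition hval (p : seq (A * bool)) : hnn :=
  \prod_(x <- p) (of_base x.1 * tstable x.2).

Lemma hval_nil : hval [::] = 1. Proof. exact: big_nil. Qed.
Lemma hval_cons a e p : hval ((a, e) :: p) = of_base a * tstable e * hval p.
Proof. exact: big_cons. Qed.
Lemma hval_cat p q : hval (p ++ q) = hval p * hval q.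
Proof. exact: big_cat. Qed.

Definition no_pinch (x y : A * bool) : bool :=
  `[< ~ (y.2 = ~~ x.2 /\ in_edge x.2 y.1) >].

Lemma path_no_pinch a b e p :
  path no_pinch (a, e) p = path no_pinch (b, e) p.
Proof. by case: p. Qed.

(** A product without pinch can be applied to a base point letter by letter, from the
    right, and no stable letter ever cancels: each of them is pushed on the normal
    form. The leftmost coefficient is changed only by an element of the edge group. *)
Lemma hval_normal a e p v : sorted no_pinch ((a, e) :: p) ->
  exists c r l, val (hval ((a, e) :: p) (omega_base v)) =
                (a * f (~~ e) c, (e, r) :: l) /\ size l = size p.
Proof.
elim: p a e => [|[b e'] p ih] a e.
  move=> _; exists (edge_part e v), (coset_rep e v), [::]; split=> //.
  by rewrite hval_cons hval_nil mulg1 bijM.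
move=> /= /andP[/asboolP np sp]; have [c [r [l [eq sl]]]] := ih b e' sp.
rewrite hval_cons bijM; set x := (hval _ _) in eq *.
rewrite bijM /= eq; case: stepP => [r' l'|_].
  case=> ee _ _ [d bd]; case: np; split=> //=.
  (* A cancellation would put [b] in the image of [f e], which is a pinch. *)
  by exists (d * c^-1); rewrite fM edge_mapV -bd ee negbK mulgK.
by eexists _, _, _; split; [reflexivity|rewrite /= sl].
Qed.

Lemma hval_len p v : sorted no_pinch p -> omega_len (hval p (omega_base v)) = size p.
Proof.
case: p => [|[a e] p] sp; first by rewrite hval_nil.
have [c [r [l [eq sl]]]] := hval_normal v sp.
by rewrite /omega_len eq /= sl.
Qed.

(** The HNN extension inside the group of all bijections. *)
Definition in_hnn (s : hnn) : Prop := exists p g, s = hval p * of_base g.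

Lemma in_hnn_of_base a : in_hnn (of_base a).
Proof. by exists [::], a; rewrite hval_nil mul1g. Qed.
Lemma in_hnn_tstable e : in_hnn (tstable e).
Proof.
by exists [:: (1, e)], 1; rewrite hval_cons hval_nil of_base1 !mulg1 mul1g.
Qed.
Lemma in_hnn1 : in_hnn 1.
Proof. by rewrite -of_base1; exact: in_hnn_of_base. Qed.
Lemma in_hnnM s s' : in_hnn s -> in_hnn s' -> in_hnn (s * s').
Proof.
move=> [p [g ->]] [[|[a e] q] [g' ->]].
  by exists p, (g * g'); rewrite hval_nil mul1g of_baseM mulgA.
exists (p ++ (g * a, e) :: q), g'.
by rewrite hval_cat !hval_cons of_baseM !mulgA.
Qed.
Lemma in_hnnV s : in_hnn s -> in_hnn s^-1.
Proof.
move=> [p [g ->]]; rewrite invgM -of_baseV; apply: in_hnnM (in_hnn_of_base _) _.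
elim: p => [|[a e] p ih]; first by rewrite hval_nil invg1; exact: in_hnn1.
rewrite hval_cons invgM; apply: in_hnnM ih _.
rewrite invgM -of_baseV -tstableN.
exact: in_hnnM (in_hnn_tstable _) (in_hnn_of_base _).
Qed.

(** Multiplying a reduced expression on the left by a t^e creates at most one pinch,
    and replacing it by its value removes both of its stable letters. *)
Lemma in_hnn_reduced s : in_hnn s ->
  exists p g, sorted no_pinch p /\ s = hval p * of_base g.
Proof.
move=> [p [g ->]] {s}; elim: p g => [|[a e] p ih] g.
  by exists [::], g.
have [[|[b e'] q] [g' [sq eq]]] := ih g.
  exists [:: (a, e)], g'; split=> //.
  by rewrite hval_cons -mulgA eq hval_nil hval_cons hval_nil mulg1 mul1g.
rewrite hval_cons -mulgA eq.
have [np|] := boolP (no_pinch (a, e) (b, e')).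
  exists ((a, e) :: (b, e') :: q), g'; split; first exact/andP.
  by rewrite [in RHS]hval_cons !mulgA.
move/asboolP => /contrapT /= [ee [c bc]]; subst e' b.
have {eq} -> : of_base a * tstable e * (hval ((f e c, ~~ e) :: q) * of_base g') =
    of_base (a * f (~~ e) c) * (hval q * of_base g').
  rewrite hval_cons of_baseM -!mulgA; congr (_ * _).
  by rewrite mulgA tstable_of_base tstableN !mulgA mulgK.
case: q sq => [|[b e'] q] sq.
  by exists [::], (a * f (~~ e) c * g'); rewrite hval_nil !mul1g !of_baseM.
exists ((a * f (~~ e) c * b, e') :: q), g'; split; last first.
  by rewrite !hval_cons !of_baseM !mulgA.
by move: sq => /= /andP[_]; rewrite (path_no_pinch b (a * f (~~ e) c * b)).
Qed.

(** A conjugation of two elements of the base of an HNN extension, decomposed into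
    conjugations in the base and passages from one copy of the edge group to the other. *)
Inductive hnn_chain : A -> A -> Prop :=
| hnn_chain_conj u h : hnn_chain u (u ^ h)
| hnn_chain_edge u h e c v :
    u ^ h = f e c -> hnn_chain (f (~~ e) c) v -> hnn_chain u v.

(** Collins' lemma for elements of the base. Write the conjugating element in reduced
    form a t^e ...; then a t^e ... v and u a t^e ... have the same value, so by
    uniqueness of normal forms [u ^ a] is in the edge group. Its passage through t^e
    leaves a shorter conjugating element. *)
Lemma hnn_conj_chain u v s : in_hnn s -> of_base v = of_base u ^ s -> hnn_chain u v.
Proof.
move=> /in_hnn_reduced[p [g [sp ->]]] {s}; elim: p u sp => [|[a e] p ih] u sp.
  rewrite hval_nil mul1g => eq.
  suff -> : v = u ^ g by exact: hnn_chain_conj.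
  by apply: of_base_inj; rewrite eq /conjg !of_baseM of_baseV.
move=> eq.
(* The equation v = u^g, written without inverses: g v = u g. *)
have eq' : hval ((a, e) :: p) * of_base (g * v) = hval ((u * a, e) :: p) * of_base g.
  rewrite of_baseM eq mulgA conjgE !mulgA mulgV mul1g.
  by rewrite !hval_cons of_baseM !mulgA.
have base s h : (s * of_base h) (omega_base 1) = s (omega_base h).
  by rewrite bijM; congr (_ _); apply: val_inj; rewrite /= mulg1.
have [c [r [l [e1 _]]]] := hval_normal (g * v) sp.
have sp' : sorted no_pinch ((u * a, e) :: p) by rewrite /= (path_no_pinch _ a).
have [c' [r' [l' [e2 _]]]] := hval_normal g sp'.
have ua : u ^ a = f (~~ e) (c * c'^-1).
  rewrite fM edge_mapV; apply: (canRL (mulgK _)).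
  have := congr1 (fun s : hnn => (val (s (omega_base 1))).1) eq'.
  by rewrite !base e1 e2 /= conjgE => /(canRL (mulKg _)) ->; rewrite !mulgA.
apply: (hnn_chain_edge ua); rewrite negbK; apply: ih.
  exact: path_sorted sp.
rewrite eq hval_cons !conjgM; congr ((_ ^ _) ^ _).
have -> : of_base u ^ of_base a = of_base (u ^ a) by rewrite !conjgE !of_baseM of_baseV.
rewrite ua conjgE; apply: (canLR (mulKg _)).
by rewrite tstable_of_base.
Qed.

(** Contrary to the lengths of elements, such bounds add up along products. *)
Definition len_bound (s : hnn) n := forall x, omega_len (s x) <= omega_len x + n.

Lemma len_bound_of_base a : len_bound (of_base a) 0.
Proof. by move=> x; rewrite addn0. Qed.
Lemma len_bound_tstable e : len_bound (tstable e) 1.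
Proof.
case=> -[a l] nl; rewrite /omega_len /=; case: stepP => [r l' -> _|_] /=.
  by rewrite addn1 /=; do 2!apply: leqW.
by rewrite addn1.
Qed.
Lemma len_boundM s s' n n' :
  len_bound s n -> len_bound s' n' -> len_bound (s * s') (n + n').
Proof.
move=> h h' x; rewrite bijM (leq_trans (h _)) // [(n + n')%N]addnC addnA.
by rewrite leq_add2r.
Qed.
Lemma len_bound_hval p : len_bound (hval p) (size p).
Proof.
elim: p => [|[a e] p ih]; first by move=> x; rewrite hval_nil addn0.
rewrite hval_cons -[size _]/(0 + 1 + size p).
apply: len_boundM ih; exact: len_boundM (len_bound_of_base _) (len_bound_tstable _).
Qed.
Lemma len_boundX s n k : len_bound s n -> len_bound (s ^+ k) (k * n).
Proof.
move=> h; elim: k => [|k ih]; first by move=> x; rewrite addn0.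
by rewrite expgS mulSn; exact: len_boundM.
Qed.
Lemma in_hnn_bound s : in_hnn s -> exists n, len_bound s n.
Proof.
move=> [p [g ->]]; exists (size p + 0).
exact: len_boundM (len_bound_hval _) (len_bound_of_base _).
Qed.

Lemma cycle_expn p k : cycle no_pinch p -> sorted no_pinch (flatten (nseq k p)).
Proof.
case: p => [|x p] cp; first by elim: k.
have lp : path no_pinch x p by move: cp; rewrite /= rcons_path => /andP[].
have lx : no_pinch (last x p) x by move: cp; rewrite /= rcons_path => /andP[].
case: k => //= k; elim: k => [|k ih] /=; first by rewrite cats0.
by rewrite cat_path lp /= lx.
Qed.

Lemma hval_flatten p k : hval (flatten (nseq k p)) = hval p ^+ k.
Proof.
by elim: k => [|k ih]; rewrite ?hval_nil //= hval_cat ih expgS.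
Qed.

(** A power of a cyclically reduced [hval p] is reduced, so that its k-th power has
    exactly k * size p stable letters. For a conjugate [s'] of [hval p], the k-th power
    has at most k * m of them up to a constant that does not depend on [k]; letting [k]
    grow gives the inequality. *)
Lemma cyclic_len_le p s s' m : cycle no_pinch p -> in_hnn s ->
  s' = hval p ^ s -> len_bound s' m -> size p <= m.
Proof.
move=> cp hs e hm; have [n hn] := in_hnn_bound hs.
have [n' hn'] := in_hnn_bound (in_hnnV hs).
(* [n] and [n'] bound the growth of length under [s] and its inverse. *)
have key k : k * size p <= k * m + (n + n').
  have := hval_len 1 (cycle_expn k cp).
  rewrite hval_flatten size_flatten /shape map_nseq sumn_nseq mulnC => <-.
  have -> : hval p ^+ k = s * s' ^+ k * s^-1.
    by rewrite e -conjXg conjgE !mulgA mulgV mul1g mulgK.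
  have := len_boundM (len_boundM hn (len_boundX k hm)) hn' (omega_base 1).
  by rewrite /omega_len /= add0n addnAC addnC.
rewrite leqNgt; apply/negP => lt.
have := key (n + n').+1.
have : (n + n').+1 * m.+1 <= (n + n').+1 * size p by rewrite leq_mul2l lt orbT.
by move=> h1 /(leq_trans h1); rewrite mulnS addnC leq_add2l ltnn.
Qed.

Definition hnn_conj (s s' : hnn) : Prop := exists2 g, in_hnn g & s' = s ^ g.

Lemma hnn_conj_sym s s' : hnn_conj s s' -> hnn_conj s' s.
Proof. by case=> g hg ->; exists g^-1; [exact: in_hnnV|rewrite conjgK]. Qed.
Lemma hnn_conj_trans s1 s2 s3 : hnn_conj s1 s2 -> hnn_conj s2 s3 -> hnn_conj s1 s3.
Proof. by case=> g hg -> [h hh ->]; exists (g * h); [exact: in_hnnM|rewrite conjgM]. Qed.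

Lemma of_base_conj_chain u v : hnn_conj (of_base u) (of_base v) -> hnn_chain u v.
Proof. by case=> g hg; exact: hnn_conj_chain. Qed.

Lemma cyclic_len_eq p q : cycle no_pinch p -> cycle no_pinch q ->
  hnn_conj (hval p) (hval q) -> size p = size q.
Proof.
move=> cp cq h; have [g' hg' e'] := hnn_conj_sym h; case: h => g hg e.
apply/eqP; rewrite eqn_leq (cyclic_len_le cp hg e (len_bound_hval q)).
exact: cyclic_len_le cq hg' e' (len_bound_hval p).
Qed.

Lemma cyclic_not_of_base p a : cycle no_pinch p -> hnn_conj (hval p) (of_base a) ->
  p = [::].
Proof.
move=> cp [g hg e]; apply/nilP; rewrite /nilp -leqn0.
exact: cyclic_len_le cp hg e (len_bound_of_base a).
Qed.

Lemma in_hnn_word (L : choiceType) (phi : L -> hnn) (w : word L) :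
  (forall x, x \in w -> in_hnn (phi x.1)) -> in_hnn (word_val phi w).
Proof.
move=> h; rewrite /word_val big_seq; apply: big_ind => [||x /h hx].
- exact: in_hnn1.
- exact: in_hnnM.
- by case: x.2; [|exact: in_hnnV].
Qed.

End HNN.

(** * Words and the groups presented by them *)
Section WordValues.
Variables (L : Type) (G : groupType) (f : L -> G).
Implicit Type w : word L.

Lemma word_val_nil : word_val f [::] = 1. Proof. exact: big_nil. Qed.
Lemma word_val_cons l (b : bool) w :
  word_val f ((l, b) :: w) = (if b then f l else (f l)^-1) * word_val f w.
Proof. exact: big_cons. Qed.
Lemma word_val1 l : word_val f [:: (l, true)] = f l.
Proof. by rewrite word_val_cons word_val_nil mulg1. Qed.
Lemma word_val_cat w w' : word_val f (w ++ w') = word_val f w * word_val f w'.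
Proof. exact: big_cat. Qed.

End WordValues.

Lemma word_val_winv (L : choiceType) (G : groupType) (f : L -> G) (w : word L) :
  word_val f (winv w) = (word_val f w)^-1.
Proof.
elim: w => [|[l b] w ih]; first by rewrite word_val_nil invg1.
rewrite word_val_cons invgM -ih /winv /= rev_cons -cats1 word_val_cat.
rewrite word_val_cons word_val_nil mulg1; congr (_ * _).
by case: b; rewrite //= invgK.
Qed.

Lemma conjugate_sym (G : groupType) (x y : G) : conjugate x y -> conjugate y x.
Proof. by case=> g ->; exists g^-1; rewrite conjgK. Qed.
Lemma conjugate_trans (G : groupType) (x y z : G) :
  conjugate x y -> conjugate y z -> conjugate x z.
Proof. by case=> g -> [h ->]; exists (g * h); rewrite conjgM. Qed.
Lemma conjugate_refl (G : groupType) (x : G) : conjugate x x.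
Proof. by exists 1; rewrite conjg1. Qed.

Section PresentedGroup.
Variables (L : choiceType) (R : word L -> word L -> Prop).
Implicit Type w : word L.

Lemma pres_classM w w' : pres_class R (w ++ w') = pres_class R w * pres_class R w'.
Proof.
apply/pres_classP; apply: pres_cat; exact/pres_sym/repr_class.
Qed.

Lemma pres_class_word_val w :
  pres_class R w = word_val (fun l => pres_class R [:: (l, true)]) w.
Proof.
elim: w => [|[l b] w ih]; first by rewrite word_val_nil.
rewrite word_val_cons -cat1s pres_classM ih; congr (_ * _).
case: b => //; apply: (mulgI (pres_class R [:: (l, true)])).
by rewrite mulgV -pres_classM; apply/pres_classP/pres_cancel.
Qed.

Lemma pres_eq_word_val (G : groupType) (f : L -> G) w w' :
    (forall w w', R w w' -> word_val f w = word_val f w') ->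
  pres_eq R w w' -> word_val f w = word_val f w'.
Proof.
move=> fR; elim=> {w w'} [w w' /fR //|l b|w1 w1' w2 w2' _ e1 _ e2|//|//|].
- by rewrite !word_val_cons word_val_nil; case: b => /=; rewrite mulg1 ?mulgV ?mulVg.
- by rewrite !word_val_cat e1 e2.
- by move=> w1 w2 w3 _ -> _ ->.
Qed.
End PresentedGroup.

Section Pi1Words.
Variable X : decomposed_graph_of_groups.
Implicit Types (Y Z : subgraph X) (w : word (letter X)).

Definition letters_in Y w : bool := all (fun x => letter_in Y x.1) w.

Definition lift_word Y (w : word {l | letter_in Y l}) : word (letter X) :=
  [seq (val x.1, x.2) | x <- w].

Lemma lift_word_in Y (w : word {l | letter_in Y l}) : letters_in Y (lift_word w).
Proof. by apply/allP => _ /mapP[x _ ->] /=; exact: valP. Qed.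

Lemma lift_wordP Y w : letters_in Y w ->
  exists w0 : word {l | letter_in Y l}, w = lift_word w0.
Proof.
elim: w => [|[l b] w ih] /=; first by exists [::].
by case/andP=> lY /ih[w0 ->]; exists ((exist _ l lY, b) :: w0).
Qed.

Lemma wval_lift Y (w : word {l | letter_in Y l}) :
  wval Y (lift_word w) = pres_class (@pi1_rel_in X Y) w.
Proof.
rewrite pres_class_word_val; elim: w => [|[l b] w ih].
  by rewrite /wval !word_val_nil.
rewrite /wval /= !word_val_cons -/(wval _ _) ih /=.
by rewrite /letter_val valK.
Qed.

Lemma wval_surj Y (g : pi1 Y) : exists2 w, letters_in Y w & wval Y w = g.
Proof.
exists (lift_word (repr g)); first exact: lift_word_in.
by rewrite wval_lift; exact: pres_class_repr.
Qed.

Lemma wval_cat Y w w' : wval Y (w ++ w') = wval Y w * wval Y w'.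
Proof. exact: word_val_cat. Qed.

Lemma wval_rel Y w w' :
  pi1_rel w w' -> letters_in Y w -> letters_in Y w' -> wval Y w = wval Y w'.
Proof.
move=> r /lift_wordP[w0 e] /lift_wordP[w0' e']; subst.
by rewrite !wval_lift; apply/pres_classP/pres_rel.
Qed.

Definition respects Y (G : groupType) (f : letter X -> G) : Prop :=
  forall w w', pi1_rel w w' -> letters_in Y w -> letters_in Y w' ->
    word_val f w = word_val f w'.

Lemma wval_eval Y (G : groupType) (f : letter X -> G) w w' :
    respects Y f -> letters_in Y w -> letters_in Y w' ->
  wval Y w = wval Y w' -> word_val f w = word_val f w'.
Proof.
move=> fR /lift_wordP[w0 ->] /lift_wordP[w0' ->] {w w'}.
rewrite !wval_lift => /pres_classP; rewrite /lift_word.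
have mapE (u : word {l | letter_in Y l}) :
    word_val f [seq (val x.1, x.2) | x <- u] = word_val (f \o val) u.
  by rewrite /word_val big_map.
rewrite !mapE; apply: pres_eq_word_val => u u' uu'; rewrite -!mapE.
by apply: fR uu' _ _; exact: lift_word_in.
Qed.

Lemma letters_in_winv Y w : letters_in Y (winv w) = letters_in Y w.
Proof. by rewrite /letters_in /winv all_rev all_map. Qed.

Lemma letters_in_cat Y w w' :
  letters_in Y (w ++ w') = letters_in Y w && letters_in Y w'.
Proof. exact: all_cat. Qed.

(** The universal property of [pi1 Y] in the form that conjugacy problems need: a
    conjugation in [pi1 Y] is carried to [G] by a family of values of the letters
    that respects the defining relations, with a conjugating element that is again
    the value of a word. *)
Lemma wval_conj_eval Y (G : groupType) (f : letter X -> G) w w' :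
    respects Y f -> letters_in Y w -> letters_in Y w' ->
    conjugate (wval Y w) (wval Y w') ->
  exists2 z, letters_in Y z & word_val f w' = word_val f w ^ word_val f z.
Proof.
move=> fR wY w'Y [g]; have [z zY <-] := wval_surj g => e.
exists z => //; have := @wval_eval Y G f w' (winv z ++ w ++ z) fR w'Y.
rewrite !word_val_cat word_val_winv conjgE => -> //.
  by rewrite !letters_in_cat letters_in_winv zY wY.
by rewrite e conjgE !wval_cat /wval word_val_winv.
Qed.

Definition subgraph_le Z Y := (sverts Z \subset sverts Y) /\ (sedges Z \subset sedges Y).

Lemma letters_in_le Z Y w : subgraph_le Z Y -> letters_in Z w -> letters_in Y w.
Proof.
case=> /fintype.subsetP hv /fintype.subsetP he; apply: sub_all => -[[x|a] b] /=.
  exact: hv.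
exact: he.
Qed.

Lemma respects_le Z Y (G : groupType) (f : letter X -> G) :
  subgraph_le Z Y -> respects Y f -> respects Z f.
Proof.
by move=> le h w w' r wZ w'Z; apply: h => //; exact: letters_in_le le _.
Qed.

Lemma respects_letter_val Y : respects Y (letter_val Y).
Proof. exact: wval_rel. Qed.

Lemma wval_le Z Y w w' : subgraph_le Z Y -> letters_in Z w -> letters_in Z w' ->
  wval Z w = wval Z w' -> wval Y w = wval Y w'.
Proof. by move=> /respects_le le; apply: wval_eval; exact/le/respects_letter_val. Qed.

Lemma conjugate_le Z Y w w' : subgraph_le Z Y -> letters_in Z w -> letters_in Z w' ->
  conjugate (wval Z w) (wval Z w') -> conjugate (wval Y w) (wval Y w').
Proof.
move=> le wZ w'Z /(wval_conj_eval (respects_le le (@respects_letter_val Y)) wZ w'Z).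
by case=> z _ e; exists (wval Y z).
Qed.

Lemma letter_valM Y s (x y : vgrp s) : s \in sverts Y ->
  letter_val Y (vlet (x * y)) = letter_val Y (vlet x) * letter_val Y (vlet y).
Proof.
move=> sY; have := wval_rel (Y := Y) (rel_vertex x y).
rewrite /letters_in /= sY /wval !word_val_cons word_val_nil !mulg1 => -> //.
Qed.

Lemma letter_val1 Y s : s \in sverts Y -> letter_val Y (vlet (1 : vgrp s)) = 1.
Proof.
move=> sY; apply: (mulgI (letter_val Y (vlet (1 : vgrp s)))).
by rewrite -letter_valM // !mulg1.
Qed.

Lemma letter_valV Y s (x : vgrp s) : s \in sverts Y ->
  letter_val Y (vlet x^-1) = (letter_val Y (vlet x))^-1.
Proof.
move=> sY; apply: (mulgI (letter_val Y (vlet x))).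
by rewrite -letter_valM // !mulgV letter_val1.
Qed.

Lemma letter_val_tree Y a : a \in sedges Y -> a \in sedges (tree X) ->
  letter_val Y (tlet a) = 1.
Proof.
move=> aY aT; have := wval_rel (Y := Y) (rel_tree aT).
by rewrite /letters_in /= aY /wval word_val1 word_val_nil => ->.
Qed.

Definition avert (a : pos_edge X) (e : bool) : vertex X :=
  if e then end_ (val a) else org (val a).
(** The two images of an element of the edge group in the vertex groups at the ends
    of [a], located at their vertices: in G_a^+ for [true], in G_a^- for [false]. *)
Definition aelt (a : pos_edge X) (e : bool) : egrp a -> {s : vertex X & vgrp s} :=
  if e then fun c => Tagged (fun s => vgrp s) (f_end a c)
  else fun c => Tagged (fun s => vgrp s) (f_org a c).
Arguments aelt a e c : clear implicits.
Definition alet a e c : letter X := inl (aelt a e c).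
Arguments alet a e c : clear implicits.

Lemma tag_aelt a e c : tag (aelt a e c) = avert a e.
Proof. by case: e. Qed.

Lemma letter_val_aletM Y a e c d : avert a e \in sverts Y ->
  letter_val Y (alet a e (c * d)) = letter_val Y (alet a e c) * letter_val Y (alet a e d).
Proof.
case: e => aY; rewrite /alet /= -letter_valM //; congr (letter_val _ (vlet _)).
  exact: gmulfM.
exact: gmulfM.
Qed.

Lemma edge_subgroupE Y a e (g : pi1 Y) : edge_subgroup a e g <->
  exists c, g = letter_val Y (alet a e c).
Proof. by rewrite /edge_subgroup /=; split; case: e => -[c ->]; exists c. Qed.

Lemma wval1 Y l : wval Y [:: (l, true)] = letter_val Y l.
Proof. exact: word_val1. Qed.

Definition vertex_inj Y := forall s (x y : vgrp s), s \in sverts Y ->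
  vertex_val Y x = vertex_val Y y -> x = y.

Lemma alet_inj Y a e : vertex_inj Y -> avert a e \in sverts Y ->
  injective (fun c => letter_val Y (alet a e c)).
Proof.
move=> inj; case: e => aY c d /inj /= h.
  exact/(f_end_inj (h aY)).
exact/(f_org_inj (h aY)).
Qed.

End Pi1Words.
Arguments aelt {X} a e c.
Arguments alet {X} a e c.

(** * Connectedness, circuits and maximal trees *)
Lemma connect_rect (T : finType) (e : rel T) (x : T) (P : T -> Prop) :
    P x -> (forall y z, connect e x y -> P y -> e y z -> P z) ->
  forall y, connect e x y -> P y.
Proof.
move=> Px ih y /connectP[p pe ->]; elim/last_ind: p pe => [|p z ihp] //.
rewrite rcons_path last_rcons => /andP[pe ez].
by apply: ih ez; [apply/connectP; exists p|exact: ihp].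
Qed.

Section Graphs.
Variable X : graph.
Implicit Types (Y Z : subgraph X) (E : {set edge X}).

Lemma subgraph_eq Y Z : sverts Y = sverts Z -> sedges Y = sedges Z -> Y = Z.
Proof.
case: Y Z => [V E cl] [V' E' cl'] /= eV eE; subst.
by congr Subgraph; exact: bool_irrelevance.
Qed.

Lemma opp_in Y a : (opp a \in sedges Y) = (a \in sedges Y).
Proof.
by apply/idP/idP => /subgraphP[]; rewrite ?oppK.
Qed.

Lemma end_opp (a : edge X) : end_ (opp a) = org a.
Proof. by rewrite end_org oppK. Qed.

Lemma org_in Y a : a \in sedges Y -> org a \in sverts Y.
Proof. by case/subgraphP. Qed.
Lemma end_in Y a : a \in sedges Y -> end_ a \in sverts Y.
Proof. by rewrite end_org => /subgraphP[/subgraphP[_ ?]]. Qed.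

Lemma adjP Y s s' :
  reflect (exists a, [/\ a \in sedges Y, org a = s & end_ a = s']) (adj Y s s').
Proof.
apply: (iffP exists_inP) => [[a aY /andP[/eqP ? /eqP ?]]|[a [aY <- <-]]].
  by exists a.
by exists a; rewrite ?eqxx.
Qed.

Lemma adj_sym Y : symmetric (adj Y).
Proof.
move=> s s'; apply/adjP/adjP => -[a [aY <- <-]]; exists (opp a).
  by rewrite opp_in end_opp -end_org.
by rewrite opp_in end_opp -end_org.
Qed.

Lemma connect_adj_sym Y : connect_sym (adj Y).
Proof. exact/sym_connect_sym/adj_sym. Qed.

Lemma adj_edge Y a : a \in sedges Y -> adj Y (org a) (end_ a).
Proof. by move=> aY; apply/adjP; exists a. Qed.

Lemma connect_mono Y Z s s' : sedges Y \subset sedges Z ->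
  connect (adj Y) s s' -> connect (adj Z) s s'.
Proof.
move=> /fintype.subsetP YZ; apply: connect_sub => x y /adjP[a [aY <- <-]].
exact/connect1/adj_edge/YZ.
Qed.

Lemma component_connected Y s : s \in sverts Y -> connected (component Y s).
Proof.
move=> sY.
(* Along a path in [Y] from [s], all edges belong to the component. *)
have key s' : connect (adj Y) s s' -> connect (adj (component Y s)) s s'.
  move: s'; apply: connect_rect => // s1 s2 c1 c2 /adjP[a [aY e1 e2]]; subst.
  apply: connect_trans c2 (connect1 (adj_edge _)).
  by rewrite inE aY.
split; first by apply/set0Pn; exists s; rewrite inE sY connect0.
move=> s1 s2; rewrite !inE => /andP[_ /key c1] /andP[_ /key c2].
by apply: connect_trans c2; rewrite connect_adj_sym.
Qed.

(** A simple path of vertices lifts to a path of edges, which cannot backtrack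
    because it would return to a vertex. *)
Lemma path_edges Y x p : path (adj Y) x p -> uniq (x :: p) -> p != [::] ->
  exists b q, [/\ all (mem (sedges Y)) (b :: q), org b = x,
    path (fun a c => (end_ a == org c) && (c != opp a)) b q,
    map (@org X) (b :: q) = belast x p & map (@end_ X) (b :: q) = p].
Proof.
elim: p x => [|y p ih] x // /andP[/adjP[b [bY bx by_]] yp] /andP[xp up] _.
have [p0|pn0] := eqVneq p [::].
  by exists b, [::]; subst p; rewrite /= bY bx by_.
have [c [q [qY cy pq mo me]]] := ih y yp up pn0.
exists b, (c :: q); split=> //=.
- by rewrite bY.
- rewrite by_ cy eqxx pq /= andbT; apply/eqP => cb.
  by move: xp; rewrite -me -bx -(end_opp b) -cb /= !inE eqxx orbT.
- by rewrite -mo bx.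
- by rewrite -me by_.
Qed.

(** A path that avoids [a] and joins its two ends would form a circuit with [opp a]. *)
Lemma circuit_cut T Y a : (forall p, ~~ circuit T p) ->
    sedges Y \subset sedges T -> a \in sedges Y ->
  ~~ connect (adj (remove Y [set a])) (org a) (end_ a).
Proof.
move=> nc /fintype.subsetP YT aY; apply/negP => /connectP[p0 pe0].
case/shortenP: pe0 => p pe up _ ea {p0}.
have aT := YT _ aY.
have [p_nil|pn0] := eqVneq p [::].
  apply: (negP (nc [:: a])); move: ea; rewrite p_nil /= => ea.
  by rewrite /circuit /= aT ea eqxx eq_sym opp_neq.
have [b [q [qY bx pq mo me]]] := path_edges pe up pn0.
have rem c : c \in b :: q -> [/\ c \in sedges T, c != a & c != opp a].
  move=> /(allP qY) /=; rewrite !inE => /and3P[cY ca oca]; split=> //.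
    exact: YT.
  by apply: contraNneq oca => ->; rewrite oppK.
have [_ bna bnoa] := rem b (mem_head _ _).
have [_ lna lnoa] := rem (last b q) (mem_last _ _).
apply: (negP (nc (opp a :: b :: q))); apply/and4P; split=> //.
- apply/allP => c; rewrite inE => /orP[/eqP->|/rem[] //].
  by rewrite /= opp_in.
- rewrite /cycle rcons_path; apply/andP; split.
    by rewrite /= end_opp bx eqxx oppK bna.
  have el : end_ (last b q) = end_ a by rewrite ea -me /= last_map.
  rewrite -end_org /= el eqxx /=.
  by apply: contra_neq lna => /(inv_inj (@oppK X)).
- rewrite map_cons mo -end_org ea.
  by move: up; rewrite lastI rcons_uniq.
Qed.

Lemma circuit_rot Y n p : circuit Y (rot n p) = circuit Y p.
Proof.
rewrite /circuit rot_cycle map_rot rot_uniq -!size_eq0 size_rot.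
by congr [&& _, _, _ & _]; apply: eq_all_r => b; rewrite mem_rot.
Qed.

(** Otherwise, by connectedness, some edge leaves [T]. Adding it together with its end
    gives a larger tree: a circuit through the new edge would have to leave the new
    vertex, where the only edge turns back. *)
Lemma maximal_tree_spans T : connected (full X) -> maximal_tree T ->
  sverts T = [set: vertex X].
Proof.
move=> [_ cX] [[[/set0Pn[s0 s0T] cT] nc] maxT].
apply/setP => v; rewrite [RHS]inE; move: (cX s0 v); rewrite !inE => /(_ isT isT).
move: v; apply: connect_rect => // x y _ oT /adjP[a [_ ex <-]]; subst x.
apply/negPn/negP => eT.
pose V := end_ a |: sverts T; pose E := [set a; opp a] :|: sedges T.
have cl : [forall b in E, (opp b \in E) && (org b \in V)].
  apply/forall_inP => b; rewrite !inE => /orP[/orP[]/eqP->|bT].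
  - by rewrite eqxx oT !orbT.
  - by rewrite oppK -end_org !eqxx.
  - by rewrite opp_in bT org_in // !orbT.
pose Z := Subgraph cl.
have TZ : sedges T \subset sedges Z by exact: finset.subsetUr.
(* The new vertex is a leaf. *)
have out b : b \in sedges Z -> org b = end_ a -> b = opp a.
  rewrite !inE => /orP[/orP[]/eqP->|bT] // eb; last by rewrite -eb org_in in eT.
  by rewrite -eb oT in eT.
suff ZT : Z = T by rewrite -ZT !inE eqxx in eT.
apply: maxT; [split| |exact: TZ]; [split| |exact: finset.subsetUr].
- by apply/set0Pn; exists s0; rewrite !inE s0T orbT.
- have c0 s : s \in sverts Z -> connect (adj Z) s0 s.
    rewrite !inE => /orP[/eqP->|sT]; last exact/(connect_mono TZ)/cT.
    apply: connect_trans (connect_mono TZ (cT _ _ s0T oT)) (connect1 _).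
    by apply: adj_edge; rewrite !inE eqxx.
  move=> s s' sZ s'Z; apply: connect_trans (c0 _ s'Z).
  by rewrite connect_adj_sym c0.
move=> p; apply/negP => cp.
have aNp : a \notin p.
  apply/negP => /rot_to[i q rq]; move: cp; rewrite -(circuit_rot _ i) rq.
  case/and4P => _ /allP qZ; rewrite /cycle => pq _.
  have [c cZ] : exists2 c, c \in sedges Z & (end_ a == org c) && (c != opp a).
    case: q qZ pq {rq} => [|c q] qZ /= /andP[pq _]; last exists c => //.
      by exists a => //; apply: qZ; rewrite inE.
    by apply: qZ; rewrite !inE eqxx orbT.
  by case/andP => /eqP ac /eqP; apply; exact: out.
have oNp : opp a \notin p.
  apply/negP => /rot_to[i q rq]; move: cp; rewrite -(circuit_rot _ i) rq.
  case/and4P => _ /allP qZ; rewrite /cycle rcons_path => /andP[_ /andP[]].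
  have lZ := qZ _ (mem_last (opp a) q).
  set l := last _ q in lZ *; rewrite -end_org => /eqP la /eqP[].
  by rewrite (out (opp l)) ?opp_in // -end_org.
apply/negP: cp; apply: contraNN (nc p) => /and4P[p0 /allP pZ cp up].
apply/and4P; split=> //; apply/allP => b bp /=; have := pZ b bp.
rewrite /= !inE => /orP[/orP[]/eqP eb|//].
  by rewrite -eb bp in aNp.
by rewrite -eb bp in oNp.
Qed.
End Graphs.

(** * Decomposing a subgraph along an edge *)
Section Pieces.
Variable X : decomposed_graph_of_groups.
Implicit Types (Y Z : subgraph X) (E : {set edge X}) (a : pos_edge X).

(** The invariant of the subgraphs met by the procedure: while there are edges outside
    the tree to remove, the whole tree remains; afterwards only tree edges are left.
    In the first situation it ensures that removing an edge outside the tree keeps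
    the subgraph connected. *)
Definition good Y : Prop :=
  connected Y /\
  (sedges Y \subset sedges (tree X) \/
   sverts Y = [set: vertex X] /\ sedges (tree X) \subset sedges Y).

(** The edge [a] may be used to decompose [Y]: a tree edge only when the other edges of
    [Y] are tree edges too, since it then separates [Y]. *)
Definition splits Y a : Prop :=
  val a \in sedges Y /\
  (val a \in sedges (tree X) -> sedges Y \subset sedges (tree X)).

(** The two factors of an amalgam, or twice the base of an HNN extension. This common
    indexing makes [avert a i] a vertex of [piece Y a i] in both cases. *)
Definition piece Y a (i : bool) : subgraph X :=
  if val a \in sedges (tree X) then factor Y a i else base Y a.

Lemma is_pieceP Y a Z : is_piece Y a Z <-> exists i, Z = piece Y a i.
Proof.
rewrite /is_piece /piece; case: ifP => _; first by [].
by split=> [->|[_ ->] //]; exists true.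
Qed.

Lemma good_full : good (full X).
Proof.
split; first exact: gog_connected.
by right; split=> //; apply/fintype.subsetP => b _; rewrite inE.
Qed.

Lemma avert_in Y a e : val a \in sedges Y -> avert a e \in sverts Y.
Proof. by move=> aY; case: e; [exact: end_in|exact: org_in]. Qed.

Lemma base_edges Y a b :
  (b \in sedges (base Y a)) = [&& b \in sedges Y, b != val a & b != opp (val a)].
Proof. by rewrite !inE (inv_eq (@oppK X)). Qed.

Lemma factor_edges Y a i b : (b \in sedges (factor Y a i)) =
  (b \in sedges (base Y a)) && connect (adj (base Y a)) (avert a i) (org b).
Proof. by rewrite inE. Qed.

Lemma factor_verts Y a i s : (s \in sverts (factor Y a i)) =
  (s \in sverts Y) && connect (adj (base Y a)) (avert a i) s.
Proof. by rewrite inE. Qed.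

Lemma base_le Y a : subgraph_le (base Y a) Y.
Proof.
by split=> //; apply/fintype.subsetP => b; rewrite base_edges => /and3P[].
Qed.

Lemma factor_le Y a i : subgraph_le (factor Y a i) (base Y a).
Proof.
split; apply/fintype.subsetP => b.
  by rewrite factor_verts => /andP[].
by rewrite factor_edges => /andP[].
Qed.

Lemma subgraph_le_trans Y Y' Z :
  subgraph_le Y Y' -> subgraph_le Y' Z -> subgraph_le Y Z.
Proof.
move=> [v e] [v' e']; split; first exact: fintype.subset_trans v v'.
exact: fintype.subset_trans e e'.
Qed.

Lemma piece_le Y a i : subgraph_le (piece Y a i) Y.
Proof.
rewrite /piece; case: ifP => _; last exact: base_le.
exact: subgraph_le_trans (factor_le _ _ _) (base_le _ _).
Qed.

Lemma avert_piece Y a i : splits Y a -> avert a i \in sverts (piece Y a i).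
Proof.
move=> [aY _]; rewrite /piece; case: ifP => _; last exact: (avert_in i aY).
by rewrite factor_verts connect0 avert_in.
Qed.

Lemma piece_edges_lt Y a i : splits Y a -> #|sedges (piece Y a i)| < #|sedges Y|.
Proof.
move=> [aY _]; apply/proper_card/properP; split; first by have [] := piece_le Y a i.
exists (val a) => //; rewrite /piece.
by case: ifP => _; rewrite ?factor_edges base_edges eqxx andbF.
Qed.

Lemma tree_connected : connected (tree X).
Proof. by have [[]] := tree_maximal X. Qed.
Lemma tree_spans : sverts (tree X) = [set: vertex X].
Proof. exact: maximal_tree_spans (gog_connected X) (tree_maximal X). Qed.

Lemma tree_cut Y a : splits Y a -> val a \in sedges (tree X) ->
  ~~ connect (adj (base Y a)) (org (val a)) (end_ (val a)).
Proof.
move=> [aY YT] aT; apply: circuit_cut (YT aT) aY.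
by have [[]] := tree_maximal X.
Qed.

Lemma factors_disjoint Y a s : splits Y a -> val a \in sedges (tree X) ->
  s \in sverts (factor Y a false) -> s \in sverts (factor Y a true) -> False.
Proof.
move=> sp aT; rewrite !factor_verts => /andP[_ c] /andP[_ c'].
apply: (negP (tree_cut sp aT)); apply: connect_trans c _.
by rewrite connect_adj_sym.
Qed.

(** Follow a path of [Y] from the origin of [a]: it leaves a component only by crossing
    [a] or its opposite, and then arrives at an end of [a]. *)
Lemma piece_cover Y a s : good Y -> splits Y a -> s \in sverts Y ->
  exists i, s \in sverts (piece Y a i).
Proof.
move=> [[_ cY] _] [aY _] sY; rewrite /piece.
case: (val a \in sedges (tree X)); last by exists true.
have := cY (org (val a)) s (org_in aY) sY; move: {sY} s.
apply: connect_rect.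
  by exists false; rewrite factor_verts connect0 andbT; exact: org_in.
move=> s s' _ [i si] /adjP[b [bY eb eb']]; subst s s'.
have [->|ba] := eqVneq b (val a).
  by exists true; rewrite factor_verts connect0 end_in.
have [->|boa] := eqVneq b (opp (val a)).
  by exists false; rewrite end_opp factor_verts connect0 org_in.
move: si; rewrite factor_verts => /andP[_ c]; exists i.
rewrite factor_verts end_in //=.
by apply: connect_trans c (connect1 (adj_edge _)); rewrite base_edges bY ba.
Qed.

Lemma factor_edge_cover Y a b : good Y -> splits Y a -> val a \in sedges (tree X) ->
  b \in sedges (base Y a) -> exists i, b \in sedges (factor Y a i).
Proof.
move=> gY sp aT bb; have [bY _] := and3P (etrans (esym (base_edges _ _ _)) bb).
have [i] := piece_cover gY sp (org_in bY); rewrite /piece aT factor_verts => /andP[_ c].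
by exists i; rewrite factor_edges bb.
Qed.

Lemma good_piece Y a i : good Y -> splits Y a -> good (piece Y a i).
Proof.
move=> [cY gY] sp; have [aY aT] := sp; rewrite /piece; case: ifP => aT'.
  split; first by apply: component_connected; exact: (avert_in i aY).
  left; apply: fintype.subset_trans (aT aT').
  by have [_] := subgraph_le_trans (factor_le Y a i) (base_le Y a).
have TY : sverts Y = [set: vertex X] /\ sedges (tree X) \subset sedges (base Y a).
  case: gY => [/fintype.subsetP/(_ _ aY)|[vY /fintype.subsetP TY]]; first by rewrite aT'.
  split=> //; apply/fintype.subsetP => b bT; rewrite base_edges TY //=.
  apply/andP; split; apply: contraFneq aT' => e; move: bT; rewrite e //.
  by rewrite opp_in.
case: TY => vY TY; split; last by right.
split; first by have [] := cY.
move=> s s' _ _; apply: connect_mono TY _.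
by have [_ cT] := tree_connected; apply: cT; rewrite tree_spans inE.
Qed.

(** [Y] is a connected component of the full graph deprived of the edges of [E].
    Contrary to [component], this does not single out a vertex. *)
Definition comp_of Y E : Prop :=
  connected Y /\
  forall b, b \in sedges Y = [&& org b \in sverts Y, b \notin E & opp b \notin E].

Lemma comp_ofE Y E s : comp_of Y E -> s \in sverts Y ->
  Y = component (remove (full X) E) s.
Proof.
move=> [[_ cY] eY] sY.
have YR : sedges Y \subset sedges (remove (full X) E).
  by apply/fintype.subsetP => b; rewrite eY !inE => /and3P[_ -> ->].
have cl s' : connect (adj (remove (full X) E)) s s' -> s' \in sverts Y.
  move: s'; apply: connect_rect => // s1 s2 _ h /adjP[b [bR eb eb']]; subst.
  by apply: end_in; rewrite eY h; move: bR; rewrite !inE.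
have vE s' : (s' \in sverts Y) = connect (adj (remove (full X) E)) s s'.
  by apply/idP/idP => [s'Y|/cl //]; apply: connect_mono YR _; exact: cY.
apply: subgraph_eq; apply/setP => b; first by rewrite !inE vE.
by rewrite eY !inE vE /= andbC.
Qed.

Lemma comp_of_piece Y E E' a i : comp_of Y E -> good Y -> splits Y a ->
    E \subset E' ->
    (forall b, b \in sedges Y ->
       (b \notin E') && (opp b \notin E') = (b != val a) && (b != opp (val a))) ->
  comp_of (piece Y a i) E'.
Proof.
move=> [cY eY] gY sp /fintype.subsetP EE' E'Y.
have [cP _] := good_piece i gY sp; split=> // b.
have bE : b \in sedges (base Y a) = [&& org b \in sverts Y, b \notin E' & opp b \notin E'].
  rewrite base_edges; have [bY|bY] := boolP (b \in sedges Y).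
    by rewrite E'Y // (org_in bY).
  apply/esym/negbTE; apply: contraNN bY => /and3P[ob bE' obE'].
  by rewrite eY ob (contraNN (EE' _) bE') (contraNN (EE' _) obE').
rewrite /piece; case: ifP => _; last exact: bE.
rewrite factor_edges factor_verts bE.
by case: (org b \in _); case: connect; rewrite ?andbF ?andbT.
Qed.

End Pieces.

(** * Occurrent subgraphs *)

Section Order.
Variables (X : decomposed_graph_of_groups) (le : rel (pos_edge X)).
Hypothesis ho : decomposition_order le.
Implicit Types (Y Z : subgraph X) (a b : pos_edge X).

Lemma pos_or (b : edge X) : b \in pos X \/ opp b \in pos X.
Proof. by have := pos_orientation b; case: (b \in pos X) => /= ->; [left|right]. Qed.

Lemma opp_pos a b : val a != opp (val b).
Proof.
apply/eqP => e; have := pos_orientation (val b).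
by rewrite -e (valP a) (valP b).
Qed.

Lemma min_edge_splits Y a : min_edge le Y a -> splits Y a.
Proof.
have [_ anti _ _ nt] := ho; move=> [aY am]; split=> // aT.
have posT (b : pos_edge X) : val b \in sedges Y -> val b \in sedges (tree X).
  move=> bY; apply/negPn/negP => bT.
  have ab : a = b by apply: anti; rewrite am // nt.
  by rewrite -ab aT in bT.
apply/fintype.subsetP => b bY; case: (pos_or b) => bp.
  exact: (posT (exist _ b bp)).
by rewrite -opp_in; apply: (posT (exist _ (opp b) bp)); rewrite /= opp_in.
Qed.

Lemma min_edge_uniq Y a b : min_edge le Y a -> min_edge le Y b -> a = b.
Proof.
have [_ anti _ _ _] := ho; move=> [aY am] [bY bm].
by apply: anti; rewrite am // bm.
Qed.

(** Allowing [n = 0] covers the full graph, so that no case distinction is left. *)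
Definition occurs Y : Prop :=
  exists n, n <= #|{: pos_edge X}| /\ comp_of Y (first_edges le n).

Lemma occurs_full : occurs (full X).
Proof.
exists 0; split=> //; split; first exact: gog_connected.
by move=> b; rewrite !inE /= take0.
Qed.

Let order_seq := sort le (enum {: pos_edge X}).

Lemma mem_order_seq b : b \in order_seq.
Proof. by rewrite mem_sort mem_enum. Qed.

Lemma first_edges_pos n b : (val b \in first_edges le n) = (index b order_seq < n).
Proof.
rewrite inE mem_map; last exact: val_inj.
by rewrite (in_take _ (mem_order_seq b)).
Qed.

Lemma first_edges_opp n b : (opp (val b) \in first_edges le n) = false.
Proof.
rewrite inE; apply/negbTE/negP => /mapP[c _ /esym/eqP].
by rewrite (negPf (opp_pos c b)).
Qed.

Lemma occurs_occurrent Y : occurs Y -> occurrent le Y.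
Proof.
move=> [[|n] [nN cY]].
  left; have [[/set0Pn[s sY] _] _] := cY; rewrite (comp_ofE cY sY).
  apply/esym/comp_ofE; last by rewrite inE.
  by split; [exact: gog_connected|move=> b; rewrite !inE /= take0].
right; have [[/set0Pn[s sY] _] _] := cY; exists n.+1, s.
by rewrite nN; split=> //; exact: comp_ofE.
Qed.

(** If [a] is the n-th edge in the order, the pieces of [Y] are components of the graph
    deprived of its first n edges: among these, the only one in [Y] is [a], its minimum. *)
Lemma occurs_piece Y a i : good Y -> min_edge le Y a -> occurs Y ->
  occurs (piece Y a i).
Proof.
move=> gY am [n [nN cY]]; have sp := min_edge_splits am.
have [_ anti tr tot _] := ho.
have so : sorted le order_seq by exact: sort_sorted.
have refl : reflexive le by case: ho.
exists (index a order_seq).+1; split.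
  by rewrite cardT -(size_sort le) index_mem mem_order_seq.
apply: (comp_of_piece _ cY gY sp).
  (* [a] is an edge of [Y], so it is not among the first [n] edges. *)
  have na : n <= index a order_seq.
    rewrite leqNgt -first_edges_pos; have [aY _] := am.
    by move: aY; rewrite (proj2 cY) => /and3P[].
  apply/fintype.subsetP => b; have [bp|bp] := pos_or b.
    rewrite -[b]/(val (exist _ b bp : pos_edge X)) !first_edges_pos => bn.
    exact: leq_trans bn (leqW na).
  rewrite -[b]oppK -[opp b]/(val (exist _ (opp b) bp : pos_edge X)).
  by rewrite first_edges_opp.
have key (c : pos_edge X) : val c \in sedges Y ->
    (val c \notin first_edges le (index a order_seq).+1) = (val c != val a).
  move=> cY'; rewrite first_edges_pos ltnS; congr (~~ _).
  apply/idP/eqP => [ca|/val_inj-> //].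
  have lca := sorted_leq_index tr refl so _ _ (mem_order_seq c) (mem_order_seq a) ca.
  by congr val; apply: anti; rewrite lca; case: am => _ ->.
move=> b bY; have [bp|bp] := pos_or b.
  rewrite -[b]/(val (exist _ b bp : pos_edge X)) key // first_edges_opp andbT.
  by rewrite opp_pos andbT.
rewrite -[b]oppK -[opp b]/(val (exist _ (opp b) bp : pos_edge X)).
rewrite first_edges_opp oppK key //= ?opp_in // (inj_eq (inv_inj (@oppK X))).
by rewrite [opp (opp b) == _]eq_sym (opp_pos a (exist _ (opp b) bp)).
Qed.
End Order.

(** * Mapping the group of a subgraph to an HNN extension *)
Section Splittings.
Variable X : decomposed_graph_of_groups.
Implicit Type Gen : forall s : vertex X, set (vgrp s).
Implicit Types (Y Z : subgraph X) (w : word (letter X)) (a : pos_edge X).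

Lemma word_on_letters Gen Y w : word_on Gen Y w -> letters_in Y w.
Proof.
move=> wY; apply/allP => x /wY; case: x => -[l|b] c /=; first by case.
by case.
Qed.

Definition awrd a e (c : egrp a) : word (letter X) := [:: (alet a e c, true)].
Arguments awrd a e c : clear implicits.

Lemma awrd_in Y a e c : splits Y a -> letters_in (piece Y a e) (awrd a e c).
Proof.
by move=> sp; rewrite /letters_in /= tag_aelt avert_piece.
Qed.

(** The counterpart of [hnn_chain] for the pieces of [Y], on words with the index of a
    piece that contains them. *)
Inductive split_chain Y a : bool -> word (letter X) -> bool -> word (letter X) -> Prop :=
| split_chain_conj i w j w' : piece Y a i = piece Y a j ->
    conjugate (wval (piece Y a i) w) (wval (piece Y a i) w') ->
    split_chain Y a i w j w'
| split_chain_edge i w e (c : egrp a) j w' : piece Y a i = piece Y a e ->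
    conjugate (wval (piece Y a i) w) (wval (piece Y a i) (awrd a e c)) ->
    split_chain Y a (~~ e) (awrd a (~~ e) c) j w' ->
    split_chain Y a i w j w'.

Lemma split_chain_conjl Y a i w w1 j w' :
    conjugate (wval (piece Y a i) w) (wval (piece Y a i) w1) ->
  split_chain Y a i w1 j w' -> split_chain Y a i w j w'.
Proof.
move=> h ch; case: ch h => {i w1 j w'} [i w1 j w' e c|i w1 e c j w' ie h ch] h'.
  by apply: split_chain_conj e (conjugate_trans h' c).
by apply: split_chain_edge ie (conjugate_trans h' h) ch.
Qed.

(** A comparison of [pi1 Y], decomposed along [a], with an HNN extension: words have
    values there, conjugate words have conjugate values, and words on the pieces are
    conjugate into the base. Both kinds of decomposition provide one, and the two facts
    about conjugacy needed below are proved from it. The shift accounts for the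
    conventions on lengths: n + 1 for n stable letters in an HNN extension, n factors
    in an amalgam. *)
Record hnn_image Y a : Type := HnnImage {
  img_base : groupType;
  img_edge : bool -> egrp a -> img_base;
  img_edgeM : forall e, {morph img_edge e : c d / c * d};
  img_edge_inj : forall e, injective (img_edge e);
  img_word : word (letter X) -> hnn img_edge;
  img_piece : bool -> word (letter X) -> img_base;
  img_conj : forall w w', letters_in Y w -> letters_in Y w' ->
    conjugate (wval Y w) (wval Y w') ->
    hnn_conj img_edgeM img_edge_inj (img_word w) (img_word w');
  img_pieceP : forall i w, letters_in (piece Y a i) w ->
    hnn_conj img_edgeM img_edge_inj (img_word w) (of_base img_edge (img_piece i w));
  img_chain : forall i j w w', letters_in (piece Y a i) w ->
    letters_in (piece Y a j) w' ->
    hnn_chain img_edge (img_piece i w) (img_piece j w') -> split_chain Y a i w j w';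
  img_shift : nat;
  img_cyclic : forall Gen w n, cyclically_reduced_word Gen Y a w n -> 1 < n ->
    exists q, [/\ cycle (no_pinch img_edge) q,
                  hnn_conj img_edgeM img_edge_inj (img_word w) (hval img_edgeM img_edge_inj q),
                  q != [::] & (size q + img_shift)%N = n] }.

(** * Decomposing along an edge outside the tree *)

Section HNNCase.
Variables (Y : subgraph X) (a : pos_edge X).
Hypotheses (aY : val a \in sedges Y) (aT : val a \notin sedges (tree X)).
Let B := base Y a.
Hypothesis B_inj : vertex_inj B.

Let f e c : pi1 B := letter_val B (alet a e c).
Let aB e : avert a e \in sverts B. Proof. exact: avert_in aY. Qed.
Let fM e : {morph f e : c d / c * d}.
Proof. by move=> c d; exact: letter_val_aletM. Qed.
Let f_inj e : injective (f e).
Proof. exact: alet_inj B_inj (aB e). Qed.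

Definition hnn_letter (l : letter X) : hnn f :=
  match l with
  | inl _ => of_base f (letter_val B l)
  | inr b => if b == val a then tstable fM f_inj true
             else if b == opp (val a) then tstable fM f_inj false
             else of_base f (letter_val B l)
  end.

Let phi := word_val hnn_letter.

Lemma hnn_letter_base l : letter_in B l -> hnn_letter l = of_base f (letter_val B l).
Proof.
case: l => // b; rewrite /letter_in base_edges => /and3P[_ ba boa] /=.
by rewrite (negPf ba) (negPf boa).
Qed.

Lemma hnn_word_base w : letters_in B w -> phi w = of_base f (wval B w).
Proof.
rewrite /phi /wval; elim: w => [|[l b] w ih] /=; first by rewrite !word_val_nil of_base1.
case/andP=> /hnn_letter_base lE /ih {}ih.
by rewrite !word_val_cons lE ih of_baseM; case: b; rewrite ?of_baseV.
Qed.

Lemma hnn_in l : in_hnn fM f_inj (hnn_letter l).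
Proof.
case: l => [x|b] /=; first exact: in_hnn_of_base.
by do 2![case: ifP => _; first exact: in_hnn_tstable]; exact: in_hnn_of_base.
Qed.

(** An edge relation for [a] is the relation of the stable letter; all the other
    relations hold in the group of the base already. *)
Lemma hnn_respects : respects Y hnn_letter.
Proof.
have inB w w' : pi1_rel w w' -> letters_in B w -> letters_in B w' -> phi w = phi w'.
  by move=> r wB w'B; rewrite !hnn_word_base // (wval_rel r).
move=> w w' r; have := inB w w' r; rewrite /phi => {}inB.
case: r inB => {w w'} [s x y|b h|b|b bT] inB wY w'Y.
- exact: inB.
- have [ba|ba] := eqVneq b a.
    subst b; rewrite word_val1 !word_val_cons word_val_nil mulg1 /= eqxx.
    by rewrite mulgA; apply: (canRL (mulgK _)); exact/esym/(tstable_of_base fM f_inj true).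
  have bB : val b \in sedges B.
    rewrite base_edges opp_pos (inj_eq val_inj) ba !andbT.
    by move: w'Y => /andP[].
  apply: inB; first by apply/andP; split=> //; exact: (org_in bB).
  by apply/and4P; split=> //; exact: (end_in bB).
- have bY : b \in sedges Y by move: w'Y => /andP[].
  have [->|ba] := eqVneq b (val a).
    rewrite !word_val_cons word_val_nil !mulg1 /= (negPf (opp_neq _)) !eqxx.
    by rewrite -tstableN.
  have [->|boa] := eqVneq b (opp (val a)).
    rewrite !word_val_cons word_val_nil !mulg1 /= oppK (negPf (opp_neq _)) !eqxx.
    by rewrite -tstableN.
  have bB : b \in sedges B by rewrite base_edges bY ba.
  have obB : opp b \in sedges B by rewrite opp_in.
  by apply: inB; apply/andP; split.
- have bB : b \in sedges B.
    rewrite base_edges; move: wY => /andP[/= -> _] /=.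
    apply/andP; split; apply: contraNneq aT => e; move: bT; rewrite e //.
    by rewrite opp_in.
  by apply: inB => //; apply/andP; split.
Qed.

Lemma pieceB i : piece Y a i = B.
Proof. by rewrite /piece (negPf aT). Qed.

Lemma hnn_split_chain i j w w' : letters_in (piece Y a i) w ->
    letters_in (piece Y a j) w' ->
  hnn_chain f (wval B w) (wval B w') -> split_chain Y a i w j w'.
Proof.
move eu : (wval B w) => u; move ev : (wval B w') => v wB w'B ch.
elim: ch i w eu ev wB => {u v} [u h|u h e c v uh _ ih] i w eu ev wB.
  apply: split_chain_conj; rewrite !pieceB //.
  by rewrite ev eu; exists h.
apply: (@split_chain_edge _ _ _ _ e c); rewrite ?pieceB //.
  by rewrite eu wval1; exists h.
apply: ih => //; first by rewrite wval1.
by apply: awrd_in; split=> //; rewrite (negPf aT).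
Qed.

Lemma hnn_word_val p g : (forall x, x \in p -> letters_in B x.1) -> letters_in B g ->
  phi (hnn_word a p g) =
    hval fM f_inj [seq (wval B x.1, x.2) | x <- p] * of_base f (wval B g).
Proof.
move=> pB gB; rewrite /phi word_val_cat -hnn_word_base //; congr (_ * _).
elim: p pB => [|[w e] p ih] pB; first by rewrite word_val_nil hval_nil.
rewrite /= word_val_cat hval_cons ih; last by move=> x xp; apply: pB; rewrite inE xp orbT.
have wB : letters_in B w := pB (w, e) (mem_head _ _).
congr (_ * _); rewrite word_val_cat -/(phi w) hnn_word_base //.
congr (_ * _); rewrite word_val_cons word_val_nil mulg1 /= eqxx.
by case: (e) => //=; rewrite -tstableN.
Qed.

Lemma hnn_no_pinch g e g' e' : letters_in B g' -> ~ pinch Y a e g' e' ->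
  no_pinch f (g, e) (wval B g', e').
Proof.
move=> g'B np; apply/asboolP => -[/= ee [c cE]]; apply: np; split=> //.
apply/edge_subgroupE; exists c; rewrite -wval1.
apply: wval_le (base_le Y a) g'B _ _; last by rewrite wval1.
by rewrite /letters_in /= tag_aelt aB.
Qed.

Lemma hnn_cyclic Gen w n : cyclically_reduced_word Gen Y a w n -> 1 < n ->
  exists q, [/\ cycle (no_pinch f) q, hnn_conj fM f_inj (phi w) (hval fM f_inj q),
                q != [::] & (size q + 1)%N = n].
Proof.
rewrite /cyclically_reduced_word (negPf aT) => -[p [g [[[pB gB red] cyc] -> ->]]].
have pB' x : x \in p -> letters_in B x.1 by move=> /pB /word_on_letters.
have gB' := word_on_letters gB.
move=> n1; exists [seq (wval B x.1, x.2) | x <- p].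
rewrite addn1 size_map -size_eq0 size_map; split=> //; last by case: (size p) n1.
- case: p cyc red pB' {pB n1} => [|[g1 e1] p] //= [_ cyc] red pB'.
  rewrite rcons_path; apply/andP; split.
    elim: p g1 e1 red pB' {cyc} => [|[g2 e2] p ih] g1 e1 red pB' //=.
    rewrite hnn_no_pinch /=; last by apply: (red [::]).
      apply: ih => [p1 p2 g3 e3 g4 e4 e|x xp].
        by apply: (red ((g1, e1) :: p1) p2); rewrite e.
      by apply: pB'; rewrite inE xp orbT.
    by apply: (pB' (g2, e2)); rewrite !inE eqxx orbT.
  have g1B := pB' (g1, e1) (mem_head _ _).
  case: cyc => [->|np] /=.
    by apply/asboolP => -[]; case: (e1).
  rewrite (last_map (fun x => (wval B x.1, x.2)) p (g1, e1)) .
  move: np; rewrite (last_map snd p (g1, e1)) /=; case: last => g2 e2 /=.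
  exact: hnn_no_pinch.
- rewrite hnn_word_val //; case: p cyc n1 {red pB pB'} => // -[g1 e1] p [g_1 _] _.
  (* The base embeds, so that [g] is trivial there as well. *)
  have -> : wval B g = 1.
    apply: (@of_base_inj _ _ f); rewrite of_base1 -hnn_word_base // /phi.
    have gY := letters_in_le (base_le Y a) gB'.
    have := wval_eval hnn_respects gY (isT : letters_in Y [::]).
    by rewrite word_val_nil => -> //; rewrite g_1 /wval word_val_nil.
  by rewrite of_base1 mulg1; exists 1; rewrite ?conjg1 //; exact: in_hnn1.
Qed.

Lemma hnn_case_image : inhabited (hnn_image Y a).
Proof.
constructor.
apply: (@HnnImage Y a (pi1 B) f fM f_inj phi (fun=> wval B) _ _ _ 1 _).
- move=> w w' wY w'Y /(wval_conj_eval hnn_respects wY w'Y)[z _ e].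
  by exists (phi z); [apply: in_hnn_word => x _; exact: hnn_in|].
- move=> i w; rewrite pieceB => wB; rewrite hnn_word_base //.
  by exists 1; rewrite ?conjg1 //; exact: in_hnn1.
- exact: hnn_split_chain.
- exact: hnn_cyclic.
Qed.

End HNNCase.

(** * Decomposing along an edge of the tree *)

Section AmalgamCase.
Variables (Y : subgraph X) (a : pos_edge X).
Hypotheses (gY : good Y) (sp : splits Y a) (aT : val a \in sedges (tree X)).
Let F i := factor Y a i.
Hypothesis F_inj : forall i, vertex_inj (F i).

Let aF e : avert a e \in sverts (F e).
Proof. by have := avert_piece e sp; rewrite /piece aT. Qed.
Let FT i b : b \in sedges (F i) -> b \in sedges (tree X).
Proof.
have [_ le] := subgraph_le_trans (factor_le Y a i) (base_le Y a).
by move=> /(fintype.subsetP le); exact: (fintype.subsetP (proj2 sp aT)).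
Qed.

Let A : groupType := (pi1 (F false) * pi1 (F true))%type.
(** The amalgam of G and H along C maps to the HNN extension of G x H that conjugates
    the two copies of C: send G to itself and H to t H t^-1. A reduced form
    g1 h1 g2 h2 ... becomes g1 t h1 t^-1 g2 t h2 t^-1 ..., which has no pinch since no
    factor is in C. Thus the results on HNN extensions apply to amalgams. *)
Definition in_factor i : pi1 (F i) -> A :=
  if i then fun g => (1, g) else fun g => (g, 1).
Arguments in_factor i g : clear implicits.

Lemma in_factorM i : {morph in_factor i : g h / g * h}.
Proof.
by case: i => g h; congr pair; rewrite ?mulg1.
Qed.
Lemma in_factor1 i : in_factor i 1 = 1. Proof. by case: i. Qed.
Lemma in_factor_inj i : injective (in_factor i).
Proof. by case: i => g h []. Qed.

Lemma in_factor_neq i j g h : i != j -> in_factor i g = in_factor j h ->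
  g = 1 /\ h = 1.
Proof. by case: i j g h => -[] //= g h _ [-> ->]. Qed.

Lemma in_factorJ i g (k : A) : exists k', in_factor i g ^ k = in_factor i (g ^ k').
Proof.
case: i g k => g [k1 k2]; [exists k2|exists k1].
  by rewrite !conjgE /=; congr pair; rewrite /= mul1g mulVg.
by rewrite !conjgE /=; congr pair; rewrite /= mul1g mulVg.
Qed.

Let f e c : A := in_factor e (letter_val (F e) (alet a e c)).
Let fM e : {morph f e : c d / c * d}.
Proof. by move=> c d; rewrite /f letter_val_aletM // in_factorM. Qed.
Let f_inj e : injective (f e).
Proof. by move=> c d /in_factor_inj; exact: (alet_inj (@F_inj e) (aF e)). Qed.

Let twist i : hnn f := if i then tstable fM f_inj false else 1.

Definition amalgam_letter (l : letter X) : hnn f :=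
  match l with
  | inl x => if tag x \in sverts (F false)
             then of_base f (in_factor false (letter_val (F false) l))
             else of_base f (in_factor true (letter_val (F true) l)) ^ twist true
  | inr _ => 1
  end.

Let phi := word_val amalgam_letter.

Lemma amalgam_letter_factor i l : letter_in (F i) l ->
  amalgam_letter l = of_base f (in_factor i (letter_val (F i) l)) ^ twist i.
Proof.
case: l => [x|b] lF; last first.
  rewrite -[inr b]/(tlet b) letter_val_tree //; last exact: FT lF.
  by rewrite in_factor1 of_base1 conj1g.
move: lF; rewrite /letter_in /=; case: i => xF.
  by rewrite ifN //; apply/negP => xF'; exact: (factors_disjoint sp aT xF' xF).
by rewrite xF conjg1.
Qed.

Lemma amalgam_word_factor i w : letters_in (F i) w ->
  phi w = of_base f (in_factor i (wval (F i) w)) ^ twist i.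
Proof.
rewrite /phi /wval; elim: w => [|[l b] w ih] /=.
  by rewrite !word_val_nil in_factor1 of_base1 conj1g.
case/andP=> /amalgam_letter_factor lE /ih {}ih.
rewrite !word_val_cons lE ih in_factorM of_baseM conjMg; congr (_ * _).
case: b => //; rewrite -conjVg -of_baseV; congr (of_base f _ ^ _).
apply: (mulgI (in_factor i (letter_val (F i) l))).
by rewrite mulgV -in_factorM mulgV in_factor1.
Qed.

Lemma twist_in i : in_hnn fM f_inj (twist i).
Proof. by case: i; [exact: in_hnn_tstable|exact: in_hnn1]. Qed.

Lemma amalgam_in l : in_hnn fM f_inj (amalgam_letter l).
Proof.
case: l => [x|b] /=; last exact: in_hnn1.
case: ifP => _; first exact: in_hnn_of_base.
rewrite conjgE; apply: in_hnnM; first exact/in_hnnV/(twist_in true).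
exact: in_hnnM (in_hnn_of_base _ _ _) (twist_in true).
Qed.

(** A relation lies in one of the two factors, unless it comes from the edge [a]; the
    twist of the second factor turns the latter into the relation of the stable letter. *)
Lemma amalgam_respects : respects Y amalgam_letter.
Proof.
have inF i w w' : pi1_rel w w' -> letters_in (F i) w -> letters_in (F i) w' ->
    phi w = phi w'.
  by move=> r wF w'F; rewrite !(@amalgam_word_factor i) // (wval_rel r).
have cover s : s \in sverts Y -> exists i, s \in sverts (F i).
  by move=> /(piece_cover gY sp); rewrite /piece aT.
move=> w w' r; have := fun i => inF i w w' r; rewrite /phi => {}inF.
case: r inF => {w w'} [s x y|b h|b|b bT] inF wY w'Y.
- have [i si] := cover s (proj1 (andP wY)).
  by apply: (inF i); rewrite /letters_in /= si.
- have [ba|ba] := eqVneq b a.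
    subst b; rewrite (_ : word_val _ [:: _; _; _] = phi (awrd a true h)); last first.
      by rewrite /phi !word_val_cons word_val_nil /= invg1 !mulg1 mul1g.
    rewrite -[LHS]/(phi (awrd a false h)).
    have inF' e : letters_in (F e) (awrd a e h).
      by apply/andP; split=> //; rewrite /= tag_aelt.
    rewrite !(amalgam_word_factor (inF' _)) conjg1 !wval1.
    rewrite -[in_factor false _]/(f false h) -[in_factor true _]/(f true h).
    rewrite conjgE -(tstableN fM f_inj false) /= mulgA tstable_of_base /= -mulgA.
    by rewrite (tstableN fM f_inj true) mulgV mulg1.
  have bB : val b \in sedges (base Y a).
    rewrite base_edges opp_pos (inj_eq val_inj) ba !andbT.
    by move: w'Y => /andP[].
  have [i bF] := factor_edge_cover gY sp aT bB.
  apply: (inF i); first by apply/andP; split=> //; exact: (org_in bF).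
  by apply/and4P; split=> //; exact: (end_in bF).
- by rewrite !word_val_cons word_val_nil /= invg1.
- by rewrite !word_val_cons word_val_nil /= mulg1.
Qed.

Lemma pieceF i : piece Y a i = F i.
Proof. by rewrite /piece aT. Qed.

(** In a direct product, an element of one factor can be conjugate to an element of the
    other one only if both are trivial; the chain then passes through the trivial
    element of the edge group. *)
Lemma amalgam_split_chain i j w w' : letters_in (piece Y a i) w ->
    letters_in (piece Y a j) w' ->
  hnn_chain f (in_factor i (wval (F i) w)) (in_factor j (wval (F j) w')) ->
  split_chain Y a i w j w'.
Proof.
have conj1 k w1 w2 : wval (F k) w1 = 1 -> wval (F k) w2 = 1 ->
    conjugate (wval (piece Y a k) w1) (wval (piece Y a k) w2).
  by rewrite pieceF => -> ->; exact: conjugate_refl.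
have awrd1 e : wval (F e) (awrd a e 1) = 1.
  apply: (@in_factor_inj e); rewrite in_factor1 wval1 -[LHS]/(f e 1).
  by rewrite edge_map1.
move eu : (in_factor i _) => u; move ev : (in_factor j _) => v wF w'F ch.
elim: ch i w eu ev wF => {u v} [u h|u h e c v uh _ ih] i w eu ev wF.
  have [k] := in_factorJ (wval (F i) w) h; rewrite eu -ev => e.
  have [ij|ij] := eqVneq i j.
    subst j; apply: split_chain_conj => //; rewrite !pieceF.
    by exists k; apply: in_factor_inj e.
  have [w1 w'1] := in_factor_neq ij (esym e).
  have {}w1 : wval (F i) w = 1 by apply: (@conjg_inj _ k); rewrite conj1g.
  apply: (@split_chain_edge _ _ _ _ i 1) => //; first exact: conj1.
  have -> : ~~ i = j by case: (i) (j) ij => [] [].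
  by apply: split_chain_conj => //; exact: conj1.
have [k] := in_factorJ (wval (F i) w) h; rewrite eu uh => ek.
have next : split_chain Y a (~~ e) (awrd a (~~ e) c) j w'.
  by apply: ih; rewrite ?wval1 //; exact: awrd_in.
have [ie|ie] := eqVneq i e.
  subst i; apply: split_chain_edge next => //; rewrite !pieceF wval1.
  by exists k; exact: in_factor_inj ek.
have [w1 c1] := in_factor_neq ie (esym ek).
have {}w1 : wval (F i) w = 1 by apply: (@conjg_inj _ k); rewrite conj1g.
have {}c1 : c = 1.
  by apply: (@f_inj e); rewrite edge_map1 // /f c1 in_factor1.
have ei : ~~ e = i by case: (i) (e) ie => [] [].
rewrite ei c1 in next; apply: split_chain_conjl next; exact: conj1.
Qed.

Let tail (p : seq (bool * word (letter X))) : seq (A * bool) :=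
  [seq (in_factor x.1 (wval (F x.1) x.2), ~~ x.1) | x <- p].

(** Between consecutive factors the twists combine into a stable letter. *)
Lemma amalgam_word_val i w p : (forall x, x \in (i, w) :: p -> letters_in (F x.1) x.2) ->
    sorted (fun i j => i != j) (map fst ((i, w) :: p)) ->
  phi (amalgam_word ((i, w) :: p)) =
    (twist i)^-1 * hval fM f_inj (tail ((i, w) :: p))
      * twist (~~ last i (map fst p)).
Proof.
have twistN j : twist j * (twist (~~ j))^-1 = tstable fM f_inj (~~ j).
  case: j; rewrite /twist /= ?invg1 ?mulg1 //.
  by rewrite mul1g -(tstableN fM f_inj false).
have wordE j u : letters_in (F j) u ->
    phi u = (twist j)^-1 * hval fM f_inj (tail [:: (j, u)]) * twist (~~ j).
  move=> /amalgam_word_factor ->; rewrite hval_cons hval_nil mulg1.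
  by rewrite -twistN conjgE !mulgA mulgVK.
elim: p i w => [|[j u] p ih] i w pF.
  by move=> _; rewrite /amalgam_word /= cats0 (wordE i) //; exact: (pF _ (mem_head _ _)).
case/andP=> ij sp'; rewrite (hval_cat _ _ (tail [:: (i, w)]) (tail ((j, u) :: p))).
rewrite /amalgam_word /= /phi word_val_cat.
have ji : ~~ i = j by case: (i) (j) ij => [] [].
have := ih j u _ sp'; rewrite /phi /amalgam_word /= => ->; last first.
  by move=> x xp; apply: pF; rewrite inE xp orbT.
rewrite -/(phi w) (wordE i); last exact: (pF _ (mem_head _ _)).
by rewrite /= ji !mulgA mulgK.
Qed.

(** A pinch t^e c t^(~~ e) needs its coefficient in the image of [f e]; the exponent
    after the coefficient tells which image that is. *)
Lemma no_pinch_cycle (q : seq (A * bool)) :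
  (forall x, x \in q -> ~ in_edge f (~~ x.2) x.1) -> cycle (no_pinch f) q.
Proof.
move=> h; have np x y : y \in q -> no_pinch f x y.
  by move=> /h yq; apply/asboolP => -[e]; rewrite -[x.2]negbK -e.
have pth r z : {subset r <= q} -> path (no_pinch f) z r.
  elim: r z => [//|y r ih] z rq /=.
  by rewrite np ?rq ?mem_head //= ih // => y' yr; apply: rq; rewrite inE yr orbT.
case: q {h np} pth => [//|x q] pth; apply: pth => y.
by rewrite mem_rcons.
Qed.

Lemma amalgam_cyclic Gen w n : cyclically_reduced_word Gen Y a w n -> 1 < n ->
  exists q, [/\ cycle (no_pinch f) q, hnn_conj fM f_inj (phi w) (hval fM f_inj q),
                q != [::] & (size q + 0)%N = n].
Proof.
rewrite /cyclically_reduced_word aT => -[p [[[p0 pF red] cyc] -> ->]] n1.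
have [out srt] := red n1.
have pF' x : x \in p -> letters_in (F x.1) x.2 by move=> /pF /word_on_letters.
have {}cyc : head true (map fst p) <> last true (map fst p).
  by case: cyc n1 => // ->.
exists (tail p); rewrite addn0 size_map -size_eq0 size_map; split=> //.
- apply: no_pinch_cycle => _ /mapP[[i u] xp ->] /=; rewrite negbK => -[c].
  move=> /in_factor_inj e; apply: (out _ xp) => /=.
  have uE : wval Y u = letter_val Y (alet a i c).
    rewrite -wval1; apply: (@wval_le _ (F i)) => //.
    + by have := piece_le Y a i; rewrite pieceF.
    + exact: (pF' _ xp).
    + by apply/andP; split=> //; rewrite /= tag_aelt.
    + by rewrite wval1.
  apply/edge_subgroupE; exists c; rewrite uE; case: (i) => //.
  have [aY _] := sp.
  (* As t_a = 1, the two images of an element of the edge group agree in [pi1 Y]. *)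
  have := wval_rel (Y := Y) (rel_edge c).
  rewrite /letters_in /= aY (org_in aY) (end_in aY) => /(_ isT isT).
  rewrite /wval word_val1 !word_val_cons word_val_nil letter_val_tree //.
  by rewrite invg1 !mulg1 mul1g => ->.
- case: p {p0 pF red out} n1 cyc srt pF' => [//|[i u] p] _ cyc srt pF'.
  rewrite amalgam_word_val //.
  have -> : ~~ last i (map fst p) = i.
    by move: cyc => /=; case: (i) (last _ _) => [] [].
  exists (twist i)^-1; first exact/in_hnnV/twist_in.
  by rewrite conjgE invgK !mulgA mulgV mul1g mulgK.
- by rewrite -lt0n (ltn_trans _ n1).
Qed.

Lemma amalgam_case_image : inhabited (hnn_image Y a).
Proof.
constructor.
apply: (@HnnImage Y a A f fM f_inj phi (fun i w => in_factor i (wval (F i) w)) _ _ _ 0 _).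
- move=> w w' wY w'Y /(wval_conj_eval amalgam_respects wY w'Y)[z _ e].
  by exists (phi z); [apply: in_hnn_word => x _; exact: amalgam_in|].
- move=> i w; rewrite pieceF => wF; rewrite (amalgam_word_factor wF).
  by exists (twist i)^-1; rewrite ?conjgK //; exact/in_hnnV/twist_in.
- exact: amalgam_split_chain.
- exact: amalgam_cyclic.
Qed.

End AmalgamCase.

(** * Conjugacy in a decomposed group *)

Lemma hnn_image_exists Y a : good Y -> splits Y a ->
  (forall i, vertex_inj (piece Y a i)) -> inhabited (hnn_image Y a).
Proof.
move=> gY sp inj; have [aT|aT] := boolP (val a \in sedges (tree X)).
  by apply: amalgam_case_image => // i; have := inj i; rewrite /piece aT.
by apply: hnn_case_image => //; [have [] := sp|have := inj true; rewrite /piece (negPf aT)].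
Qed.

(** Collins' lemma for both kinds of decomposition. *)
Lemma conj_split_chain Y a i j w w' : good Y -> splits Y a ->
    (forall i, vertex_inj (piece Y a i)) ->
    letters_in (piece Y a i) w -> letters_in (piece Y a j) w' ->
    conjugate (wval Y w) (wval Y w') ->
  split_chain Y a i w j w'.
Proof.
move=> gY sp inj wi w'j c; have [m] := hnn_image_exists gY sp inj.
apply: (img_chain (h := m)) => //.
apply: (of_base_conj_chain (fM := @img_edgeM _ _ m) (f_inj := @img_edge_inj _ _ m)).
apply: hnn_conj_trans (hnn_conj_sym (img_pieceP m wi)) _.
apply: hnn_conj_trans (img_pieceP m w'j).
apply: img_conj c; first exact: letters_in_le (piece_le Y a i) wi.
exact: letters_in_le (piece_le Y a j) w'j.
Qed.

Lemma cyclically_reduced_size Gen Y a w w' n n' : good Y -> splits Y a ->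
    (forall i, vertex_inj (piece Y a i)) ->
    letters_in Y w -> letters_in Y w' ->
    cyclically_reduced_word Gen Y a w n -> cyclically_reduced_word Gen Y a w' n' ->
    1 < n -> 1 < n' -> conjugate (wval Y w) (wval Y w') ->
  n = n'.
Proof.
move=> gY sp inj wY w'Y cw cw' n1 n'1 c; have [m] := hnn_image_exists gY sp inj.
have [q [cq hq _ <-]] := img_cyclic m cw n1.
have [q' [cq' hq' _ <-]] := img_cyclic m cw' n'1.
congr (_ + _)%N.
apply: (cyclic_len_eq (fM := @img_edgeM _ _ m) (f_inj := @img_edge_inj _ _ m) cq cq').
apply: hnn_conj_trans (hnn_conj_sym hq) _; apply: hnn_conj_trans hq'.
exact: img_conj.
Qed.

Lemma cyclically_reduced_not_piece Gen Y a w w' n i : good Y -> splits Y a ->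
    (forall i, vertex_inj (piece Y a i)) ->
    letters_in Y w -> letters_in (piece Y a i) w' ->
    cyclically_reduced_word Gen Y a w n -> 1 < n ->
  ~ conjugate (wval Y w) (wval Y w').
Proof.
move=> gY sp inj wY w'i cw n1 c; have [m] := hnn_image_exists gY sp inj.
have [q [cq hq /eqP q0 _]] := img_cyclic m cw n1; apply: q0.
apply: (cyclic_not_of_base (fM := @img_edgeM _ _ m) (f_inj := @img_edge_inj _ _ m) cq).
apply: hnn_conj_trans (hnn_conj_sym hq) _; apply: hnn_conj_trans (img_pieceP m w'i).
by apply: img_conj c => //; exact: letters_in_le (piece_le Y a i) w'i.
Qed.

End Splittings.

(** * Trajets *)
Section TrajetTheory.
Variable X : decomposed_graph_of_groups.

Lemma trajet_conjl (s s' : vertex X) (x : vgrp s) (y : vgrp s') k :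
  trajet x y -> trajet (k * x * k^-1) y.
Proof.
move=> t; case: t k => {s s' x y} [s x y h ->|b s s1 s' x h c c' y -> bc t] k.
  by apply: (@trajet_nil _ _ _ _ (k * h)); rewrite invgM !mulgA.
by apply: (@trajet_cons _ b _ _ _ _ (k * h) c c') bc t; rewrite invgM !mulgA.
Qed.

Lemma trajet_trans (s s1 s' : vertex X) (x : vgrp s) (y : vgrp s1) (z : vgrp s') :
  trajet x y -> trajet y z -> trajet x z.
Proof.
move=> t; elim: t s' z => {s s1 x y} [s x y h -> s' z|
  b s s1 s2 x h c c' y xE bc _ ih s' z].
  exact: trajet_conjl.
by move=> /ih t; apply: trajet_cons xE bc t.
Qed.

Lemma trajet_aelt (a : pos_edge X) e c :
  trajet (tagged (aelt a e c)) (tagged (aelt a (~~ e) c)).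
Proof.
have id1 (s : vertex X) (x : vgrp s) : x = 1 * x * 1^-1 by rewrite mul1g invg1 mulg1.
have nil (s : vertex X) (x : vgrp s) : trajet x x by exact: trajet_nil (id1 _ _).
by case: e; apply: trajet_cons (id1 _ _) _ (nil _ _); constructor.
Qed.

Lemma multiplicative1 (G H : groupType) (h : {multiplicative G -> H}) : h 1 = 1.
Proof. by apply: (mulgI (h 1)); rewrite -gmulfM !mulg1. Qed.

Lemma trajet_1 (s s' : vertex X) (x : vgrp s) (y : vgrp s') :
  trajet x y -> y = 1 -> x = 1.
Proof.
elim=> {s s' x y} [s x y h -> ->|b s s1 s' x h c c' y -> bc _ ih /ih c'1].
  by rewrite mulg1 mulgV.
suff -> : c = 1 by rewrite mulg1 mulgV.
case: bc c'1 => b' d.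
  by rewrite -(multiplicative1 (f_end b')) => /f_end_inj->; exact: multiplicative1.
by rewrite -(multiplicative1 (f_org b')) => /f_org_inj->; exact: multiplicative1.
Qed.

End TrajetTheory.

Section Main.
Variable X : decomposed_graph_of_groups.
Implicit Types (Y Z : subgraph X) (w : word (letter X)) (a : pos_edge X).

Definition trajets_in Y : Prop :=
  forall (s s' : vertex X) (x : vgrp s) (y : vgrp s'), s \in sverts Y -> s' \in sverts Y ->
    conjugate (vertex_val Y x) (vertex_val Y y) -> trajet x y.

(** The embedding of vertex groups comes for free: if [x] and [y] have the same image,
    a trajet leads from [x * y^-1] to 1, and trajets preserve being trivial. *)
Lemma trajets_vertex_inj Y : trajets_in Y -> vertex_inj Y.
Proof.
move=> tY s x y sY; rewrite /vertex_val => e.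
have := tY s s (x * y^-1) 1 sY sY; rewrite /vertex_val letter_val1 //.
rewrite letter_valM // letter_valV // e mulgV => /(_ (conjugate_refl _)).
by move=> /trajet_1/(_ erefl)/(canRL (mulgVK _)); rewrite mul1g.
Qed.

(** A connected subgraph without edges has a single vertex, whose group is a retract of
    [pi1 Y]. *)
Lemma trajets_no_edge Y : good Y -> sedges Y = finset.set0 -> trajets_in Y.
Proof.
move=> [[_ cY] _] Y0 s s' x y sY s'Y.
have no b : b \notin sedges Y by rewrite Y0 finset.in_set0.
have vY s1 : s1 \in sverts Y -> s1 = s.
  move=> /(cY s _ sY); move: s1; apply: connect_rect => // s1 s2 _ _ /adjP[b [bY]].
  by rewrite (negPf (no b)) in bY.
have ss := vY s' s'Y; subst s'.
(* The letters of [Y] are elements of the group of [s]; the others may go anywhere. *)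
pose T (s : vertex X) : Type := vgrp s.
pose phi (l : letter X) : vgrp s :=
  if l is inl z then tagged_as (Tagged T (1 : vgrp s)) z else 1.
have phiE (z : vgrp s) : phi (vlet z) = z by exact: (tagged_asE (u := Tagged T (1 : vgrp s)) z).
have phi_resp : respects Y phi.
  move=> w w' r; case: r => {w w'} [s1 z t|b h|b|b _] wY w'Y.
  - have s1s := vY s1 (proj1 (andP wY)); subst s1.
    by rewrite !word_val_cons word_val_nil !mulg1 !phiE.
  - by move: w'Y => /andP[/=]; rewrite (negPf (no _)).
  - by move: wY => /andP[/=]; rewrite (negPf (no _)).
  - by move: wY => /andP[/=]; rewrite (negPf (no _)).
rewrite /vertex_val -!wval1 => /(wval_conj_eval phi_resp) [||z _].
- by rewrite /letters_in /= sY.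
- by rewrite /letters_in /= sY.
rewrite !word_val1 !phiE => ->; apply: (@trajet_nil _ _ _ _ (word_val phi z)).
by rewrite conjgE !mulgA mulgV mul1g mulgK.
Qed.

Lemma split_chain_trajet Y a i w j w' : splits Y a ->
    (forall i, trajets_in (piece Y a i)) -> split_chain Y a i w j w' ->
  forall x y : {s : vertex X & vgrp s}, w = [:: (inl x, true)] -> w' = [:: (inl y, true)] ->
    tag x \in sverts (piece Y a i) -> tag y \in sverts (piece Y a j) ->
  trajet (tagged x) (tagged y).
Proof.
move=> sp tr; elim=> {i w j w'} [i w j w' ij c|i w e c j w' ie h _ ih] x y.
  move=> ew ew' xi yj; subst w w'; apply: (tr i) => //; first by rewrite ij.
  by move: c; rewrite !wval1; case: (x) (y) => s1 x1 [s2 y1].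
move=> ew ew' xi yj; subst w w'.
apply: trajet_trans (trajet_trans _ (trajet_aelt e c)) (ih _ _ erefl erefl _ yj); last first.
  by rewrite tag_aelt avert_piece.
apply: (tr i) => //; first by rewrite ie tag_aelt avert_piece.
by move: h; rewrite !wval1 /alet; case: x (aelt a e c) {xi} => s1 x1 [s2 y1].
Qed.

(** By induction on the number of edges. The pieces have trajets, hence embedded vertex
    groups, hence embedded edge groups, so conjugacy in [pi1 Y] is given by chains; each
    link of a chain is a conjugation between vertex elements of a piece or an edge step. *)
Lemma good_trajets Y : good Y -> trajets_in Y.
Proof.
have [n] := ubnP #|sedges Y|; elim: n Y => // n ih Y; rewrite ltnS => Yn gY.
have [Y0|/set0Pn[b0 b0Y]] := eqVneq (sedges Y) finset.set0.
  exact: trajets_no_edge.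
have [b bY bT] : exists2 b, b \in sedges Y &
    b \in sedges (tree X) -> sedges Y \subset sedges (tree X).
  have [YT|/fintype.subsetPn[b bY bT]] := boolP (sedges Y \subset sedges (tree X)).
    by exists b0.
  by exists b; rewrite ?(negPf bT).
have [a sp] : exists a, splits Y a.
  have [bp|bp] := pos_or b; first by exists (exist _ b bp).
  by exists (exist _ (opp b) bp); rewrite /splits /= !opp_in.
have tr i : trajets_in (piece Y a i).
  apply: ih; last exact: good_piece.
  exact: leq_trans (piece_edges_lt i sp) Yn.
move=> s s' x y sY s'Y c.
have [i si] := piece_cover gY sp sY; have [j s'j] := piece_cover gY sp s'Y.
have inj k := trajets_vertex_inj (tr k).
have := @conj_split_chain _ Y a i j [:: (vlet x, true)] [:: (vlet y, true)] gY sp inj.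
rewrite /letters_in /= si s'j !wval1 => /(_ isT isT c) ch.
exact: (split_chain_trajet sp tr ch erefl erefl).
Qed.

Lemma good_pieces_inj Y a : good Y -> splits Y a ->
  forall i, vertex_inj (piece Y a i).
Proof. by move=> gY sp i; apply/trajets_vertex_inj/good_trajets/good_piece. Qed.

Definition elliptic Y w : Prop :=
  exists2 x : {s : vertex X & vgrp s}, tag x \in sverts Y &
    conjugate (wval Y w) (letter_val Y (inl x)).

Lemma elliptic_le Z Y w : subgraph_le Z Y -> letters_in Z w ->
  elliptic Z w -> elliptic Y w.
Proof.
move=> le wZ [x xZ c]; exists x; first exact: fintype.subsetP (proj1 le) _ xZ.
rewrite -wval1; apply: (conjugate_le le) => //; last by rewrite wval1.
by rewrite /letters_in /= xZ.
Qed.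

Lemma elliptic_conj Y w w' : conjugate (wval Y w) (wval Y w') ->
  elliptic Y w -> elliptic Y w'.
Proof.
by move=> c [x xY c']; exists x => //; exact: conjugate_trans (conjugate_sym c) c'.
Qed.

(** * Successive cyclic reductions *)

Section Words.
Variable Gen : forall s : vertex X, set (vgrp s).

Lemma word_single s w : word_on Gen (single s) w ->
  exists x : vgrp s, forall Y, s \in sverts Y -> wval Y w = vertex_val Y x.
Proof.
elim: w => [|[l b] w ih] wS.
  by exists 1 => Y sY; rewrite /vertex_val letter_val1 // /wval word_val_nil.
have [|x xE] := ih; first by move=> y yw; apply: wS; rewrite inE yw orbT.
have := wS (l, b) (mem_head _ _); case: l {wS ih} => [[s' z] [/=]|c []]; last first.
  by rewrite finset.in_set0.
rewrite inE => /eqP ss _; subst s'.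
exists ((if b then z else z^-1) * x) => Y sY.
rewrite /vertex_val letter_valM // /wval word_val_cons -/(wval Y w) xE //.
by case: b; rewrite ?letter_valV.
Qed.

Lemma word_single_elliptic s w : word_on Gen (single s) w -> elliptic (single s) w.
Proof.
move=> /word_single[x xE]; exists (Tagged (fun s => vgrp s) x); first by rewrite inE.
by rewrite xE ?inE //; exact: conjugate_refl.
Qed.

(** The first link of a chain that goes through the edge would make [w] conjugate to an
    element of an edge group, which lies in a vertex group. *)
Lemma split_chain_elliptic Y a i w j w' : splits Y a -> split_chain Y a i w j w' ->
  ~ elliptic (piece Y a i) w ->
  piece Y a i = piece Y a j /\ conjugate (wval (piece Y a i) w) (wval (piece Y a i) w').
Proof.
move=> sp ch; case: ch => {i w j w'} [//|i w e c j w' ie h _] [].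
exists (aelt a e c); first by rewrite ie tag_aelt avert_piece.
by rewrite -wval1.
Qed.

Section Order.
Variables (le : rel (pos_edge X)) (ho : decomposition_order le).

Lemma cyclic_reductions_inv Y w w1 Z : cyclic_reductions Gen le Y w w1 Z ->
  [\/ exists s, Y = single s,
      exists a n, [/\ min_edge le Y a, word_on Gen Y w1,
        cyclically_reduced_word Gen Y a w1 n, conjugate (wval Y w) (wval Y w1) & 1 < n]
    | exists a w' i, [/\ min_edge le Y a, conjugate (wval Y w) (wval Y w'),
        word_on Gen (piece Y a i) w' & cyclic_reductions Gen le (piece Y a i) w' w1 Z]].
Proof.
case=> {Y w w1 Z} [s w|Y a w w1 n am w1Y cyc c n1|Y a w w' Y' w1 Z am _ _ c].
- by apply: Or31; exists s.
- by apply: Or32; exists a, n.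
- by move=> /is_pieceP[i ->] w'i h; apply: Or33; exists a, w', i.
Qed.

Lemma cyclic_reductions_conj Y w w1 Z : cyclic_reductions Gen le Y w w1 Z ->
    word_on Gen Y w ->
  letters_in Y w1 /\ conjugate (wval Y w) (wval Y w1).
Proof.
elim=> {Y w w1 Z} [s w /word_on_letters wY|Y a w w1 n _ /word_on_letters ? _ ? _ _ //|].
  by split=> //; exact: conjugate_refl.
move=> Y a w w' Y' w1 Z _ _ _ c /is_pieceP[i Y'E] w'Y' _ ih _; subst Y'.
have [w1i c'] := ih w'Y'; have le_i := piece_le Y a i.
split; first exact: letters_in_le le_i w1i.
apply: conjugate_trans c (conjugate_le le_i _ w1i c').
exact: word_on_letters w'Y'.
Qed.

(** An elliptic element never has a cyclically reduced form of length greater than 1,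
    and it remains elliptic in the piece to which the procedure passes. So the procedure
    can only stop at a vertex. *)
Lemma elliptic_output Y w w1 Z : cyclic_reductions Gen le Y w w1 Z -> good Y ->
    word_on Gen Y w -> elliptic Y w ->
  exists s, word_on Gen (single s) w1.
Proof.
elim=> {Y w w1 Z} [s w|Y a w w1 n am w1Y cyc c n1|Y a w w' Y' w1 Z am _ _ c].
- by move=> _ wS _; exists s.
- move=> gY wY [x xY cx]; have sp := min_edge_splits ho am.
  have [i xi] := piece_cover gY sp xY.
  have inj := good_pieces_inj gY sp.
  case: (cyclically_reduced_not_piece (i := i) (w' := [:: (inl x, true)]) gY sp inj _ _ cyc n1).
  + exact: word_on_letters w1Y.
  + by rewrite /letters_in /= xi.
  + by rewrite wval1; exact: conjugate_trans (conjugate_sym c) cx.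
- move=> /is_pieceP[i Y'E] w'i _ ih gY wY ell; subst Y'.
  have sp := min_edge_splits ho am; apply: ih => //; first exact: good_piece.
  have [x xY cx] := elliptic_conj c ell.
  have [j xj] := piece_cover gY sp xY.
  apply: contrapT => nell; have [] := split_chain_elliptic (j := j) (w' := [:: (inl x, true)]) sp _ nell.
    apply: (conj_split_chain gY sp (good_pieces_inj gY sp)).
    + exact: word_on_letters w'i.
    + by rewrite /letters_in /= xj.
    + by rewrite wval1.
  move=> ij; rewrite wval1 => c'; apply: nell.
  by exists x; rewrite ?ij // -ij.
Qed.

Lemma cyclically_reduced_length Y a w n : cyclically_reduced_word Gen Y a w n ->
  has_length Gen a (wval Y w) n.
Proof.
rewrite /cyclically_reduced_word /has_length; case: ifP => _.
  by move=> [p [[red _] -> ->]]; exists p.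
by move=> [p [g [[red _] -> ->]]]; exists p, g.
Qed.

(** For conjugate elements that are not elliptic the two runs of the procedure stay in
    the same subgraph: as long as the length is 1, they pass to the same piece and remain
    conjugate there, and they stop together since conjugate cyclically reduced elements
    have the same length. *)
Lemma hyperbolic_outputs Y w w1 Z : cyclic_reductions Gen le Y w w1 Z ->
  forall w' w1' Z', cyclic_reductions Gen le Y w' w1' Z' ->
    good Y -> occurs le Y -> word_on Gen Y w -> word_on Gen Y w' ->
    conjugate (wval Y w) (wval Y w') -> ~ elliptic Y w ->
  exists (Xp : subgraph X) a n,
     [/\ occurrent le Xp,
         word_on Gen Xp w1 /\ word_on Gen Xp w1',
         conjugate (wval Xp w1) (wval Xp w1'),
         min_edge le Xp a
       & [/\ has_length Gen a (wval Xp w1) n,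
             has_length Gen a (wval Xp w1') n & 1 < n]].
Proof.
elim=> {Y w w1 Z} [s w|Y a w w1 n am w1Y cyc c n1|
  Y a w w2 Y' w1 Z am w2Y cyc c /is_pieceP[i Y'E] w2i _ ih] w' w1' Z'.
- by move=> _ _ _ wS _ _ []; exact: word_single_elliptic.
- move=> h gY oY wY w'Y cw nell; have sp := min_edge_splits ho am.
  have inj := good_pieces_inj gY sp.
  have c1 : conjugate (wval Y w1) (wval Y w').
    exact: conjugate_trans (conjugate_sym c) cw.
  case: (cyclic_reductions_inv h) => [[s YS]|[a' [n' [am' w1'Y cyc' c' n'1]]]|].
  + subst Y; case: nell; apply: elliptic_conj (conjugate_sym cw) _.
    exact: word_single_elliptic.
  + have aa := min_edge_uniq ho am' am; subst a'.
    have c2 := conjugate_trans c1 c'.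
    have nn := cyclically_reduced_size gY sp inj (word_on_letters w1Y)
                 (word_on_letters w1'Y) cyc cyc' n1 n'1 c2; subst n'.
    exists Y, a, n; split=> //; first exact: occurs_occurrent.
    by split=> //; exact: cyclically_reduced_length.
  + move=> [a' [w2 [i [am' c' w2i _]]]]; have aa := min_edge_uniq ho am' am; subst a'.
    case: (cyclically_reduced_not_piece gY sp inj (word_on_letters w1Y)
             (word_on_letters w2i) cyc n1).
    exact: conjugate_trans c1 c'.
- move=> h gY oY wY w'Y cw nell; subst Y'.
  have sp := min_edge_splits ho am; have inj := good_pieces_inj gY sp.
  have c1 : conjugate (wval Y w2) (wval Y w').
    exact: conjugate_trans (conjugate_sym c) cw.
  case: (cyclic_reductions_inv h) => [[s YS]|[a' [n' [am' w1'Y cyc' c' n'1]]]|].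
  + subst Y; case: nell; apply: elliptic_conj (conjugate_sym cw) _.
    exact: word_single_elliptic.
  + have aa := min_edge_uniq ho am' am; subst a'.
    case: (cyclically_reduced_not_piece gY sp inj (word_on_letters w1'Y)
             (word_on_letters w2i) cyc' n'1).
    exact: conjugate_sym (conjugate_trans c1 c').
  + move=> [a' [w3 [j [am' c' w3j h3]]]]; have aa := min_edge_uniq ho am' am; subst a'.
    have nell' : ~ elliptic (piece Y a i) w2.
      move=> /(elliptic_le (piece_le Y a i) (word_on_letters w2i)) ell.
      by apply: nell; apply: elliptic_conj (conjugate_sym c) ell.
    have ch := conj_split_chain gY sp inj (word_on_letters w2i)
                 (word_on_letters w3j) (conjugate_trans c1 c').
    have [ij c23] := split_chain_elliptic sp ch nell'.
    rewrite -ij in w3j h3; apply: (ih _ _ _ h3) => //.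
    * exact: good_piece.
    * exact: occurs_piece.
Qed.

End Order.
End Words.
End Main.

Theorem mainTheorem3 (X : decomposed_graph_of_groups)
    (Gen : forall s : vertex X, set (vgrp s))
    (hGen : forall s : vertex X, generates (Gen s))
    (le : rel (pos_edge X)) (hle : decomposition_order le)
    (u v : pi1 (full X)) (huv : conjugate u v)
    (wu wv : word (letter X))
    (hwu : word_on Gen (full X) wu) (hu : wval (full X) wu = u)
    (hwv : word_on Gen (full X) wv) (hv : wval (full X) wv = v)
    (u1 v1 : word (letter X)) (Yu Yv : subgraph X)
    (hu1 : cyclic_reductions Gen le (full X) wu u1 Yu)
    (hv1 : cyclic_reductions Gen le (full X) wv v1 Yv) :
  (exists (s s' : vertex X) (x : vgrp s) (y : vgrp s'),
     [/\ word_on Gen (single s) u1, word_on Gen (single s') v1,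
         wval (full X) u1 = vertex_val (full X) x,
         wval (full X) v1 = vertex_val (full X) y
       & trajet x y]) \/
  (exists (Xp : subgraph X) (a : pos_edge X) (n : nat),
     [/\ occurrent le Xp,
         word_on Gen Xp u1 /\ word_on Gen Xp v1,
         conjugate (wval Xp u1) (wval Xp v1),
         min_edge le Xp a
       & [/\ has_length Gen a (wval Xp u1) n,
             has_length Gen a (wval Xp v1) n & 1 < n]]).
Proof.
subst u v; have gX := good_full X.
have [ell|nell] := pselect (elliptic (full X) wu); last first.
  right; apply: (hyperbolic_outputs hle hu1 hv1) => //; exact: occurs_full.
left; have [s us] := elliptic_output hle hu1 gX hwu ell.
have [s' vs'] := elliptic_output hle hv1 gX hwv (elliptic_conj huv ell).
have [x xE] := word_single us; have [y yE] := word_single vs'.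
have sX z : z \in sverts (full X) by rewrite inE.
exists s, s', x, y; split=> //; try by [exact: xE|exact: yE].
apply: (good_trajets gX) => //; rewrite -xE // -yE //.
have [_ cu] := cyclic_reductions_conj hu1 hwu.
have [_ cv] := cyclic_reductions_conj hv1 hwv.
exact: conjugate_trans (conjugate_sym cu) (conjugate_trans huv cv).
Qed.
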